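(* Let $N\in\mathbb{N}$ and let $\Sigma_t=\Sigma_t^\top\in\mathbb{R}^{(1+n+m)\times(1+n+m)}$, $t=0,\ldots,N$, be a sequence of matrices, partitioned as $$\Sigma_t=\begin{pmatrix}\sigma_t^{11}&\sigma_t^{12}&\sigma_t^{13}\\ \sigma_t^{21}&\Sigma_t^{22}&\Sigma_t^{23}\\ \sigma_t^{31}&\Sigma_t^{32}&\Sigma_t^{33}\end{pmatrix}$$ with block sizes $1,n,m$, that satisfies the initial condition $$\begin{pmatrix}\sigma_0^{11}&\sigma_0^{12}\\ \sigma_0^{21}&\Sigma_0^{22}\end{pmatrix}=\mathbb{E}\begin{pmatrix}1\\ x_0\end{pmatrix}\begin{pmatrix}1\\ x_0\end{pmatrix}^\top .$$ Then there exists a policy $(\mathbb{P}_{u_t})$ generating the moments $(\Sigma_t)$, i.e. such that $$\Sigma_t=\mathbb{E}\begin{pmatrix}1\\ x_t\\ u_t\end{pmatrix}\begin{pmatrix}1\\ x_t\\ u_t\end{pmatrix}^\top\qquad (t=0,\ldots,N)$$ along the random trajectory $(x_t,u_t)$ of the system under this policy, if and only if $$\Sigma_t\succeq 0\quad (t=0,\ldots,N),\qquad \widetilde F_t(\Sigma_t,\Sigma_{t+1},\Sigma_t^w)=0\quad (t=0,\ldots,N-1).\qquad (\ast)$$ Moreover, if $(\ast)$ holds, then for $t=0,\ldots,N$ there exist controller parameters $K_t=\begin{pmatrix}k_t^1&K_t^2\end{pmatrix}$ with $k_t^1\in\mathbb{R}^m$, $K_t^2\in\mathbb{R}^{m\times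 n}$, and $\Sigma_t^v\in\mathbb{R}^{m\times m}$ with $$\begin{pmatrix}\sigma_t^{31}&\Sigma_t^{32}\end{pmatrix}=\begin{pmatrix}k_t^1&K_t^2\end{pmatrix}\begin{pmatrix}\sigma_t^{11}&\sigma_t^{12}\\ \sigma_t^{21}&\Sigma_t^{22}\end{pmatrix},\qquad \Sigma_t^v=\Sigma_t^{33}-\begin{pmatrix}k_t^1&K_t^2\end{pmatrix}\begin{pmatrix}\sigma_t^{31}&\Sigma_t^{32}\end{pmatrix}^\top\succeq 0,$$ and the moments $(\Sigma_t)$ result from the particular policy $$u_t=k_t^1+K_t^2x_t+v_t,$$ where $v_0,\ldots,v_N$ are mutually independent random variables, jointly independent from $(x_0,w_0,\ldots,w_{N-1})$, such that $v_t$ has zero mean and variance $\Sigma_t^v$.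
   Context: System: $x_{t+1}=f_t+A_tx_t+B_tu_t+w_t$ for $t=0,\ldots,N-1$, with state $x_t\in\mathbb{R}^n$, input $u_t\in\mathbb{R}^m$, disturbance $w_t\in\mathbb{R}^n$, and given $f_t\in\mathbb{R}^n$, $A_t\in\mathbb{R}^{n\times n}$, $B_t\in\mathbb{R}^{n\times m}$. The initial state $x_0\sim\mathbb{P}_{x_0}$ has fixed, known, finite first and second moments. The disturbances $w_t\sim\mathbb{P}_{w_t}$ have zero mean and (finite) variance $\Sigma_t^w\in\mathbb{R}^{n\times n}$. The random variables $x_0,w_0,\ldots,w_{N-1}$ are stochastically independent. Policy: a policy $(\mathbb{P}_{u_t})$ specifies (possibly random) inputs $u_t\sim\mathbb{P}_{u_t}$, $t=0,\ldots,N$, with the restriction that, for each $t$, $u_t$ is conditionally independent from $(x_0,w_0,\ldots,w_{N-1})$ given the current state $x_t$. This holds, for example, if $u_t=\pi_t(x_t,v_t)$ with $\pi_t$ measurable and $v_0,\ldots,v_N$ mutually independent and jointly independent of $(x_0,w_0,\ldots,w_{N-1})$. Auxiliary randomness is available (the probability space may be enlarged). Trajectories considered have finite second moments. Matrix function: for symmetric $\Sigma,\Sigma_+\in\mathbb{R}^{(1+n+m)\times(1+n+m)}$, partitioned with block sizes $1,n,m$ (entries $\sigma^{11},\sigma^{12},\ldots,\Sigma^{33}$, respectively $\sigma_+^{11},\ldots,\Sigma_+^{33}$), and $\Sigma^w\in\mathbb{R}^{n\times n}$ symmetric, $$\widetilde F_t(\Sigma,\Sigma_+,\Sigma^w)=\begin{pmatrix}\sigma_+^{11}&\sigma_+^{12}\\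 \sigma_+^{21}&\Sigma_+^{22}\end{pmatrix}-\begin{pmatrix}1&0&0\\ f_t&A_t&B_t\end{pmatrix}\Sigma\begin{pmatrix}1&0&0\\ f_t&A_t&B_t\end{pmatrix}^\top-\begin{pmatrix}0&0\\0&\Sigma^w\end{pmatrix}\in\mathbb{R}^{(1+n)\times(1+n)}.$$ $\succeq 0$ denotes positive semidefiniteness of a symmetric matrix. *)

(* Defs.v *)
From HB Require Import structures.
From mathcomp Require Import all_boot all_order all_algebra.
From mathcomp Require Import all_classical all_reals all_analysis.

Set Implicit Arguments.
Unset Strict Implicit.
Unset Printing Implicit Defensive.

Import Order.TTheory GRing.Theory Num.Theory.
Import numFieldNormedType.Exports.

Local Open Scope classical_set_scope.
Local Open Scope ring_scope.

Definition measure_matrix_display : measure_display -> measure_display.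
Proof. exact. Qed.

(* The product sigma-algebra on matrices; over the reals it is the Borel one. *)
Section measurable_matrix.
Context {d : measure_display} {T : measurableType d} (p q : nat).

Definition g_sigma_entries : set (set 'M[T]_(p, q)) :=
  <<s \bigcup_(ij in [set: 'I_p * 'I_q])
        preimage_set_system setT (fun M : 'M[T]_(p, q) => M ij.1 ij.2)
          measurable >>.

Let entries_set0 : g_sigma_entries set0.
Proof. exact: sigma_algebra0. Qed.

Let entries_setC X : g_sigma_entries X -> g_sigma_entries (~` X).
Proof. exact: sigma_algebraC. Qed.

Let entries_bigcup (F : (set 'M[T]_(p, q))^nat) :
  (forall i, g_sigma_entries (F i)) -> g_sigma_entries (\bigcup_i F i).
Proof. exact: sigma_algebra_bigcup. Qed.

HB.instance Definition _ := @isMeasurable.Build (measure_matrix_display d)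
  'M[T]_(p, q) g_sigma_entries entries_set0 entries_setC entries_bigcup.

End measurable_matrix.

Definition psd (R : realType) (p : nat) (M : 'M[R]_p) : Prop :=
  M^T = M /\ forall y : 'cV[R]_p, 0 <= (y^T *m M *m y) 0 0.

Section probability.
Context {d : measure_display} {Omega : measurableType d} {R : realType}.
Variable P : probability Omega R.

Definition has_expectation (p q : nat) (Z : Omega -> 'M[R]_(p, q))
    (S : 'M[R]_(p, q)) : Prop :=
  forall i j, 'E_P[fun w => Z w i j]%E = (S i j)%:E.

Definition square_integrable (p : nat) (X : Omega -> 'cV[R]_p) : Prop :=
  forall i, (fun w => X w i 0) \in Lfun P 2%:E.

Definition has_variance (p : nat) (X : Omega -> 'cV[R]_p) (S : 'M[R]_p) :
    Prop :=
  forall i j, covariance P (fun w => X w i 0) (fun w => X w j 0) = (S i j)%:E.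

(* Some B i may be setT, so the product rule over all of 'I_k gives it over
   every subfamily. *)
Definition mutually_independent {d' : measure_display} {T : measurableType d'}
    (k : nat) (X : 'I_k -> Omega -> T) : Prop :=
  forall B : 'I_k -> set T, (forall i, measurable (B i)) ->
    P (\bigcap_i (X i @^-1` B i)) = (\prod_(i < k) P (X i @^-1` B i))%E.

Definition independent {d1 d2 : measure_display} {T1 : measurableType d1}
    {T2 : measurableType d2} (X : Omega -> T1) (Y : Omega -> T2) : Prop :=
  forall A B, measurable A -> measurable B ->
    P (X @^-1` A `&` Y @^-1` B) = (P (X @^-1` A) * P (Y @^-1` B))%E.

(* g is a version of y |-> P(E | Y = y); equivalently, g \o Y is a version of
   the conditional expectation of the indicator of E given the sigma-algebra
   of Y. *)
Definition cond_prob {d' : measure_display} {T : measurableType d'}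
    (E : set Omega) (Y : Omega -> T) (g : T -> R) : Prop :=
  [/\ measurable_fun setT g,
      P.-integrable setT (EFin \o (g \o Y)) &
      forall C, measurable C ->
        (\int[P]_(w in Y @^-1` C) (g (Y w))%:E = P (E `&` Y @^-1` C))%E].

(* Versions exist and are almost surely unique, so it does not matter which
   ones are taken. *)
Definition cond_independent {d1 d2 d3 : measure_display}
    {T1 : measurableType d1} {T2 : measurableType d2} {T3 : measurableType d3}
    (X : Omega -> T1) (Z : Omega -> T2) (Y : Omega -> T3) : Prop :=
  forall A B, measurable A -> measurable B ->
    exists gA gB gAB : T3 -> R,
      [/\ cond_prob (X @^-1` A) Y gA,
          cond_prob (Z @^-1` B) Y gB,
          cond_prob (X @^-1` A `&` Z @^-1` B) Y gAB &
          {ae P, forall w, gAB (Y w) = gA (Y w) * gB (Y w)}].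

End probability.

Record enlargement {d : measure_display} {Omega : measurableType d}
    {R : realType} (P : probability Omega R) := Enlargement {
  ext_display : measure_display;
  ext_space : measurableType ext_display;
  ext_prob : probability ext_space R;
  ext_proj : {mfun ext_space >-> Omega};
  ext_law : forall A, measurable A -> ext_prob (ext_proj @^-1` A) = P A }.

Definition stack {Omega : Type} {R : realType} (p k : nat)
    (X : nat -> Omega -> 'cV[R]_p) (w : Omega) : 'M[R]_(p, k) :=
  \matrix_(i, j) X j w i 0.

(* The family (x0, w 0, w 1, ...). *)
Definition exogenous {Omega V : Type} (x0 : Omega -> V)
    (w : nat -> Omega -> V) (t : nat) : Omega -> V :=
  if t is s.+1 then w s else x0.

(* All time-indexed data are sequences on nat; with horizon N, only
   f t, A t, B t, w t for t < N and u t, v t, Sigma t for t <= N matter. *)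
Section system.
Context {R : realType} (n m : nat).
Variables (f : nat -> 'cV[R]_n) (A : nat -> 'M[R]_n) (B : nat -> 'M[R]_(n, m)).

Definition system_mx (t : nat) : 'M[R]_(1 + n, 1 + n + m) :=
  block_mx (row_mx 1%:M 0) 0 (row_mx (f t) (A t)) (B t).

Definition Ftilde (t : nat) (S Splus : 'M[R]_(1 + n + m)) (Sw : 'M[R]_n) :
    'M[R]_(1 + n) :=
  ulsubmx Splus - system_mx t *m S *m (system_mx t)^T - block_mx 0 0 0 Sw.

Section trajectory.
Context {d : measure_display} {Omega : measurableType d}.
Variables (P : probability Omega R) (N : nat).
Variables (x0 : Omega -> 'cV[R]_n) (w : nat -> Omega -> 'cV[R]_n).
Variable (u : nat -> Omega -> 'cV[R]_m).

Fixpoint state (t : nat) (o : Omega) : 'cV[R]_n :=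
  if t is s.+1 then f s + A s *m state s o + B s *m u s o + w s o else x0 o.

Definition is_policy : Prop :=
  forall t, (t <= N)%N ->
    [/\ square_integrable P (state t), square_integrable P (u t) &
        cond_independent P (u t) (stack N.+1 (exogenous x0 w)) (state t)].

Definition generates (Sigma : nat -> 'M[R]_(1 + n + m)) : Prop :=
  forall t, (t <= N)%N ->
    let z o : 'cV[R]_(1 + n + m) := col_mx (col_mx 1%:M (state t o)) (u t o) in
    has_expectation P (fun o => z o *m (z o)^T) (Sigma t).

Definition affine_feedback (k : nat -> 'cV[R]_m) (K : nat -> 'M[R]_(m, n))
    (v : nat -> Omega -> 'cV[R]_m) : Prop :=
  forall t, (t <= N)%N -> forall o, u t o = k t + K t *m state t o + v t o.

End trajectory.

Definition is_control_noise {d : measure_display} {Omega : measurableType d}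
    (P : probability Omega R) (N : nat) (x0 : Omega -> 'cV[R]_n)
    (w : nat -> Omega -> 'cV[R]_n) (v : nat -> Omega -> 'cV[R]_m)
    (Sv : nat -> 'M[R]_m) : Prop :=
  [/\ forall t, (t <= N)%N ->
        [/\ square_integrable P (v t), has_expectation P (v t) 0 &
            has_variance P (v t) (Sv t)],
      mutually_independent P (fun t : 'I_N.+1 => v t) &
      independent P (stack N.+1 v) (stack N.+1 (exogenous x0 w))].

Definition moment_conditions (N : nat) (Sigma : nat -> 'M[R]_(1 + n + m))
    (Sw : nat -> 'M[R]_n) : Prop :=
  (forall t, (t <= N)%N -> psd (Sigma t)) /\
  (forall t, (t < N)%N -> Ftilde t (Sigma t) (Sigma t.+1) (Sw t) = 0).

End system.

(* Main.v *)
(** If the [u t] form a policy, then the pair [(x t, u t)] is independent of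
    [(w t, w t.+1, ...)]: by induction [x t] is, conditional independence
    given [x t] extends this to the pair, and the next state is a function of
    the pair and of [w t]. Hence [w t] is orthogonal to [(1, x t, u t)], and
    squaring the dynamics gives [Ftilde = 0].

    Conversely, a positive semidefinite block matrix has its lower left block
    in the row space of its upper left block, which yields the gain, and its
    Schur complement is positive semidefinite, which yields the noise
    covariance [L *m L^T]; [L] applied to independent random signs is such a
    noise. Under affine feedback [x t] is a function of [x0], the [w s] and the
    [v s] with [s < t], so [v t] is independent of [(x t, x0, w)]; this gives
    the conditional independence and propagates the second moments. *)

From HB Require Import structures.
Require Import Defs.
From mathcomp Require Import all_boot all_order all_algebra.
From mathcomp Require Import all_classical all_reals all_analysis.
From mathcomp Require Import measurable_realfun.

Set Implicit Arguments.
Unset Strict Implicit.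
Unset Printing Implicit Defensive.

Import Order.TTheory GRing.Theory Num.Theory.
Import numFieldNormedType.Exports.

Local Open Scope classical_set_scope.
Local Open Scope ring_scope.

(** * Measurability of matrix-valued maps and independence *)

(** Conditional independence is given through versions of conditional probabilities, so both
    directions work with such versions. If a function of the disturbances is independent of [x t],
    its version is almost surely constant, and integrating the product formula over an event of
    [x t] yields independence from the pair. For an input [h (x t, v t)] the versions are explicit:
    the law of [v t] on sections, and a Radon-Nikodym density for the disturbances. Independence is
    carried for all future disturbances jointly, because the induction step consumes [w t] and still
    needs the remaining ones. For vectors and families it is checked on rectangles or cylinders and
    extended by the pi-lambda theorem. The given probability space may be too poor to carry further
    randomness, hence the product with a space of coin flips. Only the covariance of the noise is
    prescribed, so signs are enough: one uniform law on a finite set serves all times, and its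
    independence and moments reduce to counting. *)

Section measurable_matrix.
Context {R : realType}.

Lemma measurable_mx_entry p q (i : 'I_p) (j : 'I_q) :
  measurable_fun setT (fun M : 'M[R]_(p, q) => M i j).
Proof.
move=> _ Y mY; rewrite setTI.
apply: sub_sigma_algebra; exists (i, j) => //.
by exists Y => //; rewrite setTI.
Qed.

Lemma measurable_mxP d (T : measurableType d) p q (g : T -> 'M[R]_(p, q)) :
  measurable_fun setT g <->
  forall i j, measurable_fun setT (fun x => g x i j).
Proof.
split=> [mg i j|mg].
  by apply: (measurableT_comp (measurable_mx_entry i j)).
apply: (measurability (\bigcup_(ij in [set: 'I_p * 'I_q])
  preimage_set_system setT (fun M : 'M[R]_(p, q) => M ij.1 ij.2)
          measurable)) => //.
move=> _ [_ [[i j] _ [Y mY <-]] <-].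
rewrite !setTI -comp_preimage.
by have := mg i j measurableT _ mY; rewrite setTI.
Qed.

Lemma measurable_addmx d (T : measurableType d) p q
    (g h : T -> 'M[R]_(p, q)) :
  measurable_fun setT g -> measurable_fun setT h ->
  measurable_fun setT (fun x => g x + h x).
Proof.
move=> /measurable_mxP mg /measurable_mxP mh; apply/measurable_mxP => i j.
under eq_fun do rewrite mxE.
exact: measurable_funD.
Qed.

Lemma measurable_mulmxl d (T : measurableType d) p q r (C : 'M[R]_(p, q))
    (g : T -> 'M[R]_(q, r)) :
  measurable_fun setT g -> measurable_fun setT (fun x => C *m g x).
Proof.
move=> /measurable_mxP mg; apply/measurable_mxP => i j.
under eq_fun do rewrite mxE.
by apply: measurable_sum => k; apply: measurable_funM.
Qed.

Lemma measurable_col_mx d (T : measurableType d) p q r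
    (g : T -> 'M[R]_(p, r)) (h : T -> 'M[R]_(q, r)) :
  measurable_fun setT g -> measurable_fun setT h ->
  measurable_fun setT (fun x => col_mx (g x) (h x)).
Proof.
move=> /measurable_mxP mg /measurable_mxP mh; apply/measurable_mxP => i j.
case: (split_ordP i) => k ->.
  by under eq_fun do rewrite col_mxEu; exact: mg.
by under eq_fun do rewrite col_mxEd; exact: mh.
Qed.

Lemma measurable_stack d (T : measurableType d) p k
    (X : nat -> T -> 'cV[R]_p) :
  (forall j, (j < k)%N -> measurable_fun setT (X j)) ->
  measurable_fun setT (stack k X).
Proof.
move=> mX; apply/measurable_mxP => i j.
under eq_fun do rewrite mxE.
by have /measurable_mxP/(_ i 0) := mX _ (ltn_ord j).
Qed.

Lemma measurable_col p q (j : 'I_q) :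
  measurable_fun setT (fun M : 'M[R]_(p, q) => col j M).
Proof.
apply/measurable_mxP => i i0; under eq_fun do rewrite mxE.
exact: measurable_mx_entry.
Qed.

Lemma col_stack (T : Type) p k (X : nat -> T -> 'cV[R]_p) w (j : 'I_k) :
  col j (stack k X w) = X j w.
Proof. by apply/matrixP => i i0; rewrite !mxE ord1. Qed.

End measurable_matrix.

(** The sets whose preimage lies in [<<s G>>] form a sigma-algebra, so generators suffice. This
    carries a product rule known on a pi-system to all events of a pair or of a stack. *)
Lemma preimage_g_sigma_algebra (T U : Type) (X : T -> U)
    (G : set (set T)) (H : set (set U)) :
    (forall S, H S -> <<s G >> (X @^-1` S)) ->
  forall S, <<s H >> S -> <<s G >> (X @^-1` S).
Proof.
move=> HG; apply: (@smallest_sub _ _ _ [set S | <<s G >> (X @^-1` S)]) => //.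
split; first exact: sigma_algebra0.
- by move=> C GC; rewrite /= setTD preimage_setC -setTD; exact: sigma_algebraCD.
- by move=> F GF; rewrite /= preimage_bigcup; exact: sigma_algebra_bigcup.
Qed.

Lemma measurable_preimageT d1 d2 (T1 : measurableType d1)
    (T2 : measurableType d2) (X : T1 -> T2) C :
  measurable_fun setT X -> measurable C -> measurable (X @^-1` C).
Proof. by move=> mX mC; rewrite -[_ @^-1` _]setTI; exact: mX. Qed.

Section independence.
Context {d : measure_display} {Omega : measurableType d} {R : realType}.
Variable P : probability Omega R.

(** Pi-lambda argument: for fixed [E], the measurable sets obeying the product rule form a Dynkin
    system. *)
Lemma g_sigma_algebra_indep (G : set (set Omega)) (E : set Omega) :
    measurable E -> G `<=` measurable -> setI_closed G ->
    (forall A, G A -> P (A `&` E) = (P A * P E)%E) ->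
  forall A, <<s G >> A -> P (A `&` E) = (P A * P E)%E.
Proof.
move=> mE Gm GI GE.
pose D := [set A | measurable A /\ P (A `&` E) = (P A * P E)%E].
suff : <<s G >> `<=` D by move=> GD A /GD [].
rewrite -setI_closed_g_dynkin_g_sigma_algebra//.
apply: smallest_sub; last by move=> A GA; split; [exact: Gm|exact: GE].
have PE : P E \is a fin_num by exact: fin_num_measure.
split.
- by split=> //; rewrite setTI probability_setT mul1e.
- move=> A [mA AE]; split; first exact: measurableC.
  rewrite setIC -setDE measureD//; last by rewrite ltey_eq PE.
  rewrite probability_setC// (setIC E) [X in (_ - X)%E]AE.
  by rewrite [RHS]muleC muleBr ?mule1 1?[(P E * _)%E]muleC// fin_num_adde_defr.
- move=> F tF FD.
  have mF n : measurable (F n) by case: (FD n).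
  split; first exact: bigcupT_measurable.
  rewrite setI_bigcupl measure_semi_bigcup//; last 3 first.
  + by move=> n; exact: measurableI.
  + exact: trivIset_setIr.
  + by apply: bigcupT_measurable => n; exact: measurableI.
  rewrite [in RHS]measure_semi_bigcup//; last exact: bigcupT_measurable.
  rewrite muleC -(fineK PE) -nneseriesZl//; apply: eq_eseriesr => n _.
  by rewrite fineK// muleC; case: (FD n) => _ <-.
Qed.

Lemma independent_sym d1 d2 (T1 : measurableType d1) (T2 : measurableType d2)
    (X : Omega -> T1) (Y : Omega -> T2) :
  independent P X Y -> independent P Y X.
Proof. by move=> XY A B mA mB; rewrite setIC XY// muleC. Qed.

Lemma independent_comp d1 d2 d3 d4
    (T1 : measurableType d1) (T2 : measurableType d2)
    (T3 : measurableType d3) (T4 : measurableType d4)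
    (X : Omega -> T1) (Y : Omega -> T2) (g : T1 -> T3) (h : T2 -> T4) :
    measurable_fun setT g -> measurable_fun setT h ->
  independent P X Y -> independent P (g \o X) (h \o Y).
Proof.
move=> mg mh XY A B mA mB.
by apply: (XY (g @^-1` A) (h @^-1` B)); exact: measurable_preimageT.
Qed.

Lemma independent_pair d1 d2 d3
    (T1 : measurableType d1) (T2 : measurableType d2) (T3 : measurableType d3)
    (X : Omega -> T1) (Y : Omega -> T2) (Z : Omega -> T3) :
    measurable_fun setT X -> measurable_fun setT Y -> measurable_fun setT Z ->
    (forall A B C, measurable A -> measurable B -> measurable C ->
      P (X @^-1` A `&` Y @^-1` B `&` Z @^-1` C) =
      (P (X @^-1` A `&` Y @^-1` B) * P (Z @^-1` C))%E) ->
  independent P (fun w => (X w, Y w)) Z.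
Proof.
move=> mX mY mZ XYZ S C mS mC.
pose G : set (set Omega) := [set E | exists A B,
  [/\ measurable A, measurable B & E = X @^-1` A `&` Y @^-1` B]].
apply: (@g_sigma_algebra_indep G).
- exact: measurable_preimageT.
- by move=> _ [A [B [mA mB ->]]]; apply: measurableI; exact: measurable_preimageT.
- move=> _ _ [A [B [mA mB ->]]] [A' [B' [mA' mB' ->]]].
  exists (A `&` A'), (B `&` B'); split; try exact: measurableI.
  by rewrite !preimage_setI setIACA.
- by move=> _ [A [B [mA mB ->]]]; exact: XYZ.
move: S mS; rewrite measurable_prod_measurableType.
apply: preimage_g_sigma_algebra => _ [A mA [B mB <-]].
by apply: sub_sigma_algebra; exists A, B.
Qed.

Lemma independent_stack d' (T : measurableType d') p k
    (Y : nat -> Omega -> 'cV[R]_p) (Z : Omega -> T) :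
    (forall j, (j < k)%N -> measurable_fun setT (Y j)) ->
    measurable_fun setT Z ->
    (forall (B : 'I_k -> set 'cV[R]_p) C,
      (forall j, measurable (B j)) -> measurable C ->
      P (\bigcap_j (Y (val j) @^-1` B j) `&` Z @^-1` C) =
      (P (\bigcap_j (Y (val j) @^-1` B j)) * P (Z @^-1` C))%E) ->
  independent P (stack k Y) Z.
Proof.
move=> mY mZ YZ S C mS mC.
pose G : set (set Omega) := [set E | exists B : 'I_k -> set 'cV[R]_p,
  (forall j, measurable (B j)) /\ E = \bigcap_j (Y (val j) @^-1` B j)].
apply: (@g_sigma_algebra_indep G).
- exact: measurable_preimageT.
- move=> _ [B [mB ->]].
  apply: fin_bigcap_measurable => [|j _]; first exact: finite_finset.
  exact: measurable_preimageT (mY _ (ltn_ord j)) (mB j).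
- move=> _ _ [A [mA ->]] [B [mB ->]]; exists (fun j => A j `&` B j); split.
    by move=> j; exact: measurableI.
  by rewrite -bigcapI.
- by move=> _ [B [mB ->]]; exact: YZ.
move: S mS; apply: preimage_g_sigma_algebra => _ [[i j] _ [B mB <-]].
apply: sub_sigma_algebra.
(* An event on the entry [(i, j)] is a cylinder that constrains column [j] only. *)
exists (fun l => if l == j then (fun M : 'cV[R]_p => M i 0) @^-1` B else setT).
split.
  move=> l; case: ifP => // _.
  exact: measurable_preimageT (measurable_mx_entry i 0) mB.
apply/seteqP; split => w /=.
  by rewrite mxE => -[_ H] l _; case: eqP => [->|].
by move=> /(_ j I); rewrite eqxx mxE.
Qed.

End independence.

(** * Expectations and second moments *)

Section expectation.
Context {d : measure_display} {Omega : measurableType d} {R : realType}.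
Variable P : probability Omega R.

Lemma Lfun_measurable p (X : Omega -> R) :
  X \in Lfun P p -> measurable_fun setT X.
Proof. by move=> /sub_Lfun_mfun; rewrite inE. Qed.

Lemma Lfun2_Lfun1 (X : Omega -> R) : X \in Lfun P 2%:E -> X \in Lfun P 1.
Proof. by apply: Lfun_subset12; exact: fin_num_measure. Qed.

(** Independence identifies the law of [(X, Y)] with the product of the marginal laws, and Fubini
    then splits the integral. *)
Lemma independent_expectationM (X Y : Omega -> R) :
    independent P X Y -> X \in Lfun P 2%:E -> Y \in Lfun P 2%:E ->
  'E_P[X \* Y]%E = ('E_P[X] * 'E_P[Y])%E.
Proof.
move=> XY LX LY.
have mX := Lfun_measurable LX; have mY := Lfun_measurable LY.
have mXY : measurable_fun setT (fun w => (X w, Y w)).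
  exact: measurable_fun_pair.
pose X' : {mfun Omega >-> R} := HB.pack X (isMeasurableFun.Build _ _ _ _ _ mX).
pose Y' : {mfun Omega >-> R} := HB.pack Y (isMeasurableFun.Build _ _ _ _ _ mY).
pose XY' : {mfun Omega >-> (R * R)%type} :=
  HB.pack (fun w => (X w, Y w)) (isMeasurableFun.Build _ _ _ _ _ mXY).
pose f (z : R * R) : \bar R := (z.1 * z.2)%:E.
have mf : measurable_fun setT f.
  by apply/measurable_EFinP; apply: measurable_funM;
    [exact: measurable_fst|exact: measurable_snd].
have lawE A : measurable A ->
    (distribution P X' \x distribution P Y')%E A = distribution P XY' A.
  move=> mA.
  apply: (@product_measure_unique _ _ _ _ _ (distribution P X')
     (distribution P Y') (distribution P XY') XY _ mA).
have /Lfun1_integrable LXY := Lfun2_mul_Lfun1 LX LY.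
(* Fubini needs integrability for the product law. It is transferred from the joint law, where it
   amounts to the integrability of a product of two square-integrable variables. *)
have intf : (distribution P X' \x distribution P Y')%E.-integrable setT f.
  have /integrableP[_ If] : (distribution P XY').-integrable setT f.
    by apply: integrable_pushforward.
  apply/integrableP; split=> //.
  apply: le_lt_trans If; rewrite le_eqVlt; apply/orP; left; apply/eqP.
  by apply: eq_measure_integral => S mS _; exact: lawE.
have /Lfun1_integrable IX := Lfun2_Lfun1 LX.
have /Lfun1_integrable IY := Lfun2_Lfun1 LY.
have EYfin : 'E_P[Y]%E \is a fin_num.
  by apply: expectation_fin_num; exact: Lfun2_Lfun1.
transitivity (\int[distribution P XY']_z f z)%E.
  by rewrite unlock integral_distribution.
transitivity (\int[distribution P X' \x distribution P Y']_z f z)%E.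
  by apply: eq_measure_integral => A mA _; apply/esym/lawE.
rewrite -integral12_prod_meas1//.
transitivity (\int[distribution P X']_x (x%:E * 'E_P[Y]))%E.
  apply: eq_integral => x _; rewrite /fubini_F/= unlock.
  rewrite -integralZl//.
  rewrite (integral_distribution (X := Y') (f := fun y => (x * y)%:E))//.
    by apply/measurable_EFinP; exact: measurable_funM.
  exact: (integrableZl _ x IY).
rewrite -(fineK EYfin) integralZr//; last first.
  by apply: integrable_pushforward => //; exact/measurable_EFinP.
rewrite (integral_distribution (X := X') (f := EFin))//.
by rewrite unlock.
Qed.

(** Linearity of the expectation needs integrability, which [has_expectation] does not record. *)
Definition has_moment p q (Z : Omega -> 'M[R]_(p, q)) (S : 'M[R]_(p, q)) :=
  forall i j, (fun w => Z w i j) \in Lfun P 1 /\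
              'E_P[fun w => Z w i j]%E = (S i j)%:E.

Lemma has_moment_expectation p q (Z : Omega -> 'M[R]_(p, q)) S :
  has_moment Z S -> has_expectation P Z S.
Proof. by move=> ZS i j; case: (ZS i j). Qed.

Lemma has_momentD p q (Z Z' : Omega -> 'M[R]_(p, q)) S S' :
  has_moment Z S -> has_moment Z' S' ->
  has_moment (fun w => Z w + Z' w) (S + S').
Proof.
move=> ZS ZS' i j; have [LZ EZ] := ZS i j; have [LZ' EZ'] := ZS' i j.
rewrite (_ : (fun w => (Z w + Z' w) i j) =
             ((fun w => Z w i j) \+ (fun w => Z' w i j))); last first.
  by apply/funext => w; rewrite mxE.
by rewrite expectationD// mxE EZ EZ'; split => //; exact: rpredD.
Qed.

Lemma expectation_bigsum I (r : seq I) (X : I -> Omega -> R) (s : I -> R) :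
    (forall k, X k \in Lfun P 1 /\ 'E_P[X k]%E = (s k)%:E) ->
  (fun w => \sum_(k <- r) X k w) \in Lfun P 1 /\
  'E_P[fun w => (\sum_(k <- r) X k w)%R]%E = (\sum_(k <- r) s k)%:E.
Proof.
move=> Xs; elim: r => [|k r [Lr Er]].
  rewrite (_ : (fun w => _) = cst 0); last first.
    by apply/funext => w; rewrite big_nil.
  by rewrite big_nil expectation_cst; split => //; exact: (Lfun_cst P 0 1).
pose Y w := \sum_(k <- r) X k w.
rewrite (_ : (fun w => _) = X k \+ Y); last first.
  by apply/funext => w; rewrite big_cons.
have [Lk Ek] := Xs k.
by rewrite expectationD// big_cons Ek Er; split => //; exact: rpredD.
Qed.

Lemma has_moment_mulmxl p q r (C : 'M[R]_(p, q)) (Z : Omega -> 'M[R]_(q, r)) S :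
  has_moment Z S -> has_moment (fun w => C *m Z w) (C *m S).
Proof.
move=> ZS i j; rewrite [in X in _ /\ X]mxE.
rewrite (_ : (fun w => _) = (fun w => \sum_k C i k * Z w k j)); last first.
  by apply/funext => w; rewrite mxE.
apply: (expectation_bigsum _ (X := fun k w => C i k * Z w k j)) => k.
have [LZ EZ] := ZS k j.
rewrite (_ : (fun w => _) = (C i k \o* (fun w => Z w k j))); last first.
  by apply/funext => w /=; rewrite mulrC.
rewrite expectationZl// EZ; split => //.
by apply: Lfun_scale; rewrite ?lexx.
Qed.

Lemma has_moment_tr p q (Z : Omega -> 'M[R]_(p, q)) S :
  has_moment Z S -> has_moment (fun w => (Z w)^T) S^T.
Proof.
move=> ZS i j; have := ZS j i; rewrite mxE.
by rewrite (_ : (fun w => (Z w)^T i j) = (fun w => Z w j i))//;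
  apply/funext => w; rewrite mxE.
Qed.

Lemma has_moment_mulmxr p q r (C : 'M[R]_(q, r)) (Z : Omega -> 'M[R]_(p, q)) S :
  has_moment Z S -> has_moment (fun w => Z w *m C) (S *m C).
Proof.
move=> /has_moment_tr/(has_moment_mulmxl C^T)/has_moment_tr.
rewrite trmx_mul !trmxK; congr has_moment.
by apply/funext => w; rewrite trmx_mul !trmxK.
Qed.

(** The mixed terms of the expanded square are linear images of [z *m W^T] and its transpose, hence
    have mean zero. It serves twice: [W] is the disturbance in the dynamics, and the control noise
    in the feedback law. *)
Lemma second_moment_affine a b p (M : 'M[R]_(a + b, p))
    (z : Omega -> 'cV[R]_p) (W : Omega -> 'cV[R]_b) S Sw :
    has_moment (fun w => z w *m (z w)^T) S ->
    has_moment (fun w => z w *m (W w)^T) 0 ->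
    has_moment (fun w => W w *m (W w)^T) Sw ->
  has_moment (fun w => (M *m z w + col_mx 0 (W w)) *m
                       (M *m z w + col_mx 0 (W w))^T)
             (M *m S *m M^T + block_mx 0 0 0 Sw).
Proof.
move=> zz zW WW.
pose J : 'M[R]_(a + b, b) := col_mx 0 1%:M.
have JE (w : Omega) : col_mx 0 (W w) = J *m W w.
  by rewrite mul_col_mx mul0mx mul1mx.
have -> : (fun w => (M *m z w + col_mx 0 (W w)) *m
                    (M *m z w + col_mx 0 (W w))^T) =
    (fun w => M *m (z w *m (z w)^T) *m M^T + J *m (W w *m (W w)^T) *m J^T +
      (M *m (z w *m (W w)^T) *m J^T + J *m (z w *m (W w)^T)^T *m M^T)).
  apply/funext => w; rewrite JE linearD /= mulmxDl !mulmxDr !trmx_mul trmxK.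
  rewrite !mulmxA -!addrA; congr (_ + _); rewrite [RHS]addrCA; congr (_ + _).
  by rewrite addrC.
have -> : M *m S *m M^T + block_mx 0 0 0 Sw =
    M *m S *m M^T + J *m Sw *m J^T + (M *m 0 *m J^T + J *m 0^T *m M^T).
  rewrite trmx0 !mulmx0 !mul0mx !addr0; congr (_ + _).
  rewrite mul_col_mx mul0mx mul1mx tr_col_mx trmx0 trmx1 mul_col_mx mul0mx.
  by rewrite mul_mx_row mulmx0 mulmx1 /block_mx row_mx0.
apply: has_momentD; apply: has_momentD.
- exact/has_moment_mulmxr/has_moment_mulmxl.
- exact/has_moment_mulmxr/has_moment_mulmxl.
- exact/has_moment_mulmxr/has_moment_mulmxl.
- exact/has_moment_mulmxr/has_moment_mulmxl/has_moment_tr.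
Qed.

Lemma square_integrable_measurable p (X : Omega -> 'cV[R]_p) :
  square_integrable P X -> measurable_fun setT X.
Proof.
move=> LX; apply/measurable_mxP => i j; rewrite ord1.
exact: Lfun_measurable (LX i).
Qed.

Lemma square_integrableD p (X Y : Omega -> 'cV[R]_p) :
  square_integrable P X -> square_integrable P Y ->
  square_integrable P (fun w => X w + Y w).
Proof.
move=> LX LY i; rewrite (_ : (fun w => _) =
  (fun w => X w i 0) \+ (fun w => Y w i 0)); last first.
  by apply/funext => w; rewrite mxE.
by apply: rpredD; [rewrite lee1n|move=> ?; exact: LX|move=> ?; exact: LY].
Qed.

Lemma square_integrable_mul p q (C : 'M[R]_(p, q)) (X : Omega -> 'cV[R]_q) :
  square_integrable P X -> square_integrable P (fun w => C *m X w).
Proof.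
move=> LX i; rewrite (_ : (fun w => _) =
  \sum_k (C i k \o* (fun w => X w k 0))); last first.
  apply/funext => w; rewrite mxE fct_sumE.
  by apply: eq_bigr => k _; rewrite /= mulrC.
apply: rpred_sum => [|? k _]; first by rewrite lee1n.
apply: (Lfun_scale _ _ (LX k)).
by rewrite ler1n.
Qed.

Lemma square_integrable_cst p (c : 'cV[R]_p) :
  square_integrable P (fun=> c).
Proof. by move=> i; exact: Lfun_cst. Qed.

Lemma square_integrable_col_mx p q (X : Omega -> 'cV[R]_p)
    (Y : Omega -> 'cV[R]_q) :
  square_integrable P X -> square_integrable P Y ->
  square_integrable P (fun w => col_mx (X w) (Y w)).
Proof.
move=> LX LY i; case: (split_ordP i) => k ->.
  by under eq_fun do rewrite col_mxEu; exact: LX.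
by under eq_fun do rewrite col_mxEd; exact: LY.
Qed.

Lemma mul_col_trE (p q : nat) (x : 'cV[R]_p) (y : 'cV[R]_q) i j :
  (x *m y^T) i j = x i 0 * y j 0.
Proof. by rewrite mxE big_ord1 mxE. Qed.

Lemma has_moment_second p (z : Omega -> 'cV[R]_p) S :
  square_integrable P z -> has_expectation P (fun w => z w *m (z w)^T) S ->
  has_moment (fun w => z w *m (z w)^T) S.
Proof.
move=> Lz ES i j; split; last exact: ES.
under eq_fun do rewrite mul_col_trE.
exact: Lfun2_mul_Lfun1 (Lz i) (Lz j).
Qed.

Lemma has_moment_independent p q (z : Omega -> 'cV[R]_p)
    (W : Omega -> 'cV[R]_q) :
    square_integrable P z -> square_integrable P W ->
    has_expectation P W 0 -> independent P z W ->
  has_moment (fun w => z w *m (W w)^T) 0.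
Proof.
move=> Lz LW EW zW i j; under eq_fun do rewrite mul_col_trE.
split; first exact: Lfun2_mul_Lfun1 (Lz i) (LW j).
rewrite independent_expectationM//; last first.
  exact: independent_comp (measurable_mx_entry i 0) (measurable_mx_entry j 0) zW.
by rewrite EW !mxE mule0.
Qed.

Lemma has_varianceP p (W : Omega -> 'cV[R]_p) Sw :
    square_integrable P W -> has_expectation P W 0 ->
  has_variance P W Sw <-> has_moment (fun w => W w *m (W w)^T) Sw.
Proof.
move=> LW EW.
have covE i j : covariance P (fun w => W w i 0) (fun w => W w j 0) =
    'E_P[fun w => (W w *m (W w)^T) i j]%E.
  rewrite covarianceE; last 3 first.
  - exact: Lfun2_Lfun1.
  - exact: Lfun2_Lfun1.
  - exact: Lfun2_mul_Lfun1.
  rewrite !EW !mxE mul0e sube0; congr expectation.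
  by apply/funext => w; rewrite mul_col_trE.
split=> [VW|WW i j]; last by rewrite covE; exact: has_moment_expectation.
by apply: has_moment_second => // i j; rewrite -covE.
Qed.

End expectation.

(** * Conditional independence *)

Section event_law.
Context {d d' : measure_display} {Omega : measurableType d}
  {T : measurableType d'} {R : realType}.
Variables (P : probability Omega R) (E : set Omega) (mE : measurable E)
  (X : {mfun Omega >-> T}).

(** The law of [X] on the event [E], left unnormalized so that [E] may be null. Its density with
    respect to the law of [X] is a version of the conditional probability of [E] given [X]. *)
Definition event_law : set T -> \bar R := pushforward (mrestr P mE) X.

Let event_law0 : event_law set0 = 0%E.
Proof. exact: measure0. Qed.

Let event_law_ge0 A : (0 <= event_law A)%E.
Proof. exact: measure_ge0. Qed.

Let event_law_sigma_additive : semi_sigma_additive event_law.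
Proof. exact: measure_semi_sigma_additive. Qed.

HB.instance Definition _ := isMeasure.Build _ _ _ event_law
  event_law0 event_law_ge0 event_law_sigma_additive.

Let event_law_fin : fin_num_fun event_law.
Proof.
move=> A mA; rewrite /event_law /pushforward /mrestr.
apply: fin_num_measure; apply: measurableI => //.
by rewrite -(setTI (_ @^-1` _)); exact: (@measurable_funP _ _ _ _ setT X).
Qed.

HB.instance Definition _ := @Measure_isFinite.Build _ _ _ event_law event_law_fin.

Lemma event_law_dominates : event_law `<< distribution P X.
Proof.
apply/null_content_dominatesP => A mA XA0.
have mXA : measurable (X @^-1` A) by exact: measurable_funPTI.
apply/eqP; rewrite eq_le event_law_ge0 andbT -[leRHS]XA0.
have mXAE : measurable (X @^-1` A `&` E).
  by apply: measurableI.
by apply: (le_measure P); rewrite ?inE//; exact: subIsetl.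
Qed.

End event_law.

Section conditional_independence.
Context {d : measure_display} {Omega : measurableType d} {R : realType}.
Variable P : probability Omega R.

Section cond_prob.
Context {d' : measure_display} {T : measurableType d'}.
Variable X : {mfun Omega >-> T}.

Lemma integrable_distribution (g : T -> R) :
  measurable_fun setT g ->
  (distribution P X).-integrable setT (EFin \o g) <->
  P.-integrable setT (EFin \o (g \o X)).
Proof.
move=> mg; have mEg : measurable_fun setT (EFin \o g) by exact/measurable_EFinP.
split=> [/integrableP[_ Ig]|Ig]; last exact: integrable_pushforward.
apply/integrableP; split; first exact: (measurableT_comp mEg).
apply: le_lt_trans Ig; rewrite ge0_integral_distribution//.
exact: measurableT_comp.
Qed.

(** Moves the defining identity from [Omega] to the value space of [X], where Radon-Nikodym
    densities and almost everywhere uniqueness apply. *)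
Lemma cond_probP (E : set Omega) (g : T -> R) : measurable_fun setT g ->
  cond_prob P E X g <->
  ((distribution P X).-integrable setT (EFin \o g) /\
   forall C, measurable C ->
     (\int[distribution P X]_(x in C) (g x)%:E = P (E `&` X @^-1` C))%E).
Proof.
move=> mg; have mEg : measurable_fun setT (EFin \o g) by exact/measurable_EFinP.
have pushE C : measurable C -> P.-integrable setT (EFin \o (g \o X)) ->
    (\int[distribution P X]_(x in C) (g x)%:E =
     \int[P]_(w in X @^-1` C) (g (X w))%:E)%E.
  move=> mC Ig; have mXC : measurable (X @^-1` C) by exact: measurable_funPTI.
  apply: (integral_pushforward _ mEg) => //.
  exact: integrableS Ig.
split=> [[_ Ig gE]|[Ig gE]]; split => //.
- exact/integrable_distribution.
- by move=> C mC; rewrite pushE// gE.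
- exact/integrable_distribution.
- by move=> C mC; rewrite -pushE ?gE//; exact/integrable_distribution.
Qed.

End cond_prob.

(** Given [X = x], the variable [h (x, V)] still has [V] distributed by its own law, and knowing [Z]
    as well does not change this. Hence the product of the two versions is a version for the
    intersection. *)
Lemma cond_independent_noise d1 d2 d3 d4 (T1 : measurableType d1)
    (T2 : measurableType d2) (T3 : measurableType d3) (T4 : measurableType d4)
    (X : {mfun Omega >-> T3}) (V : {mfun Omega >-> T4})
    (Z : {mfun Omega >-> T2}) (h : T3 * T4 -> T1) :
    measurable_fun setT h -> independent P V (fun w => (X w, Z w)) ->
  cond_independent P (fun w => h (X w, V w)) Z X.
Proof.
move=> mh VXZ A B mA mB.
have mS : measurable (h @^-1` A).
  exact: measurable_preimageT.
set S := h @^-1` A in mS.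
have mZB : measurable (Z @^-1` B) by exact: measurable_funPTI.
pose mu := distribution P X.
pose D := distribution P V.
pose qA x := D (xsection S x).
have mqA : measurable_fun setT qA by exact: measurable_fun_xsection.
have qA0 x : (0 <= qA x)%E by exact: measure_ge0.
have qA1 x : (qA x <= 1)%E.
  by apply: probability_le1; exact: measurable_xsection.
have qAfin x : qA x \is a fin_num.
  by apply: fin_num_measure; exact: measurable_xsection.
(* The conditional law of [V] given [X] and [Z] is its own law [D]. *)
have key F (mF : measurable F) : (forall C G, measurable C -> measurable G ->
      P (V @^-1` G `&` (X @^-1` C `&` F)) =
      (P (V @^-1` G) * P (X @^-1` C `&` F))%E) ->
    forall C, measurable C ->
    (\int[event_law P mF X]_(x in C) qA x =
     P ((fun w => h (X w, V w)) @^-1` A `&` F `&` X @^-1` C))%E.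
  move=> VXF C mC.
  have mXV : measurable_fun setT (fun w => (X w, V w)).
    by apply: measurable_fun_pair.
  pose XV : {mfun Omega >-> (T3 * T4)%type} :=
    HB.pack (fun w => (X w, V w)) (isMeasurableFun.Build _ _ _ _ _ mXV).
  have mSC : measurable (S `&` C `*` setT).
    by apply: measurableI => //; exact: measurableX.
  have -> : P ((fun w => h (X w, V w)) @^-1` A `&` F `&` X @^-1` C) =
      event_law P mF XV (S `&` C `*` setT).
    congr (P _); apply/seteqP; split => w /=; first by move=> [[]].
    by move=> [[? []]].
  (* On [F] the joint law of [(X, V)] is a product, by [VXF] on rectangles; its value is the
     integral of the measures of the sections. *)
  rewrite -(@product_measure_unique _ _ _ _ _ (event_law P mF X) D)//; last first.
    move=> C' G' mC' mG'.
    rewrite [RHS]muleC -[RHS]VXF//; congr (P _).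
    by apply/seteqP; split => w /=; [move=> [[]]|move=> [? []]].
  rewrite /product_measure1 integral_mkcond; apply: eq_integral => x _ /=.
  rewrite patchE; case: ifPn => [|] xC.
    congr (D _); apply/seteqP; split=> y; rewrite !xsectionE /=.
      by move=> Sy; rewrite inE in xC.
    by case.
  suff -> : xsection (S `&` C `*` setT) x = set0 by rewrite measure0.
  apply/seteqP; split => y //; rewrite xsectionE /= => -[_ [Cx _]].
  by move: xC; rewrite notin_setE.
have indepB : forall C G, measurable C -> measurable G ->
      P (V @^-1` G `&` (X @^-1` C `&` Z @^-1` B)) =
      (P (V @^-1` G) * P (X @^-1` C `&` Z @^-1` B))%E.
  by move=> C G mC mG; rewrite -(VXZ G (C `*` B))//; exact: measurableX.
have indepT : forall C G, measurable C -> measurable G ->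
      P (V @^-1` G `&` (X @^-1` C `&` setT)) =
      (P (V @^-1` G) * P (X @^-1` C `&` setT))%E.
  move=> C G mC mG; have := VXZ G (C `*` setT) mG (measurableX mC measurableT).
  suff -> : (fun w => (X w, Z w)) @^-1` (C `*` setT) = X @^-1` C `&` setT by [].
  by apply/seteqP; split => w //=.
(* The density [r] of [nu] is the conditional probability, given [X], that [Z] lies in [B]. *)
pose nu := event_law P mZB X.
have numu : nu `<< mu by exact: event_law_dominates.
pose r := Radon_Nikodym (charge_of_finite_measure nu) mu.
have rfin x : r x \is a fin_num by exact: Radon_Nikodym_fin_num.
have ir : mu.-integrable setT r by exact: Radon_Nikodym_integrable.
have mr : measurable_fun setT r by exact: measurable_int ir.
pose gA x := fine (qA x); pose gB x := fine (r x).
have gAE : EFin \o gA = qA by apply/funext => x /=; rewrite fineK.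
have gBE : EFin \o gB = r by apply/funext => x /=; rewrite fineK.
have mgA : measurable_fun setT gA by apply/measurable_EFinP; rewrite gAE.
have mgB : measurable_fun setT gB by apply/measurable_EFinP; rewrite gBE.
have gABE : EFin \o (gA \* gB) = (qA \* r)%E.
  by apply/funext => x /=; rewrite EFinM /gA /gB !fineK.
exists gA, gB, (gA \* gB); split.
- apply/cond_probP => //; split.
    rewrite gAE; apply: (@le_integrable _ _ _ mu _ _ _ (cst 1%E)) => //.
      by move=> x _; rewrite gee0_abs//= normr1 qA1.
    exact: finite_measure_integrable_cst.
  move=> C mC; rewrite -[X in _ = P (X `&` _)]setIT -(key setT measurableT)//.
  transitivity (\int[mu]_(x in C) qA x)%E.
    by apply: eq_integral => x _; rewrite -gAE.
  apply: eq_measure_integral => F mF _.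
  by rewrite -[RHS]/(P (X @^-1` F `&` setT)) setIT.
- apply/cond_probP => //; split; first by rewrite gBE.
  move=> C mC; rewrite setIC.
  transitivity (\int[mu]_(x in C) r x)%E.
    by apply: eq_integral => x _; rewrite -gBE.
  by rewrite -Radon_Nikodym_integral.
- apply/cond_probP; first exact: measurable_funM.
  split.
    rewrite gABE; apply: (@le_integrable _ _ _ mu _ _ _ r) => //.
      exact: emeasurable_funM.
    move=> x _; rewrite abseM gee0_abs//.
    by rewrite -[leRHS]mul1e lee_wpmul2r.
  (* [key] produces an integral of [qA] against [nu]; the density [r] turns it into one of [qA * r]
     against [mu]. *)
  move=> C mC; rewrite -(key _ mZB)//.
  transitivity (\int[mu]_(x in C) (qA x * r x))%E.
    by apply: eq_integral => x _; rewrite -[RHS]/((qA \* r)%E x) -gABE.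
  apply: Radon_Nikodym_change_of_variables => //.
  apply: (@le_integrable _ _ _ nu _ _ _ (cst 1%E)) => //.
  - exact: measurable_funTS.
  - by move=> x _; rewrite gee0_abs//= normr1 qA1.
  - exact: finite_measure_integrable_cst.
- by apply: aeW => w.
Qed.

(** [psi] will select the future disturbances from the whole family [Z]. Independence makes the
    version [gB] a constant [c], so [gAB] is [c] times [gA], and integration over an event of [X]
    factorizes. *)
Lemma cond_independent_pair d1 d2 d3 d4 (T1 : measurableType d1)
    (T2 : measurableType d2) (T3 : measurableType d3) (T4 : measurableType d4)
    (X : {mfun Omega >-> T3}) (U : {mfun Omega >-> T1})
    (Z : {mfun Omega >-> T2}) (psi : {mfun T2 >-> T4}) :
    cond_independent P U Z X -> independent P X (psi \o Z) ->
  independent P (fun w => (X w, U w)) (psi \o Z).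
Proof.
move=> UZX XZ.
have mpsiZ : measurable_fun setT (psi \o Z).
  exact: measurableT_comp.
apply: independent_pair => // C A D mC mA mD.
have mB : measurable (psi @^-1` D) by exact: measurable_funPTI.
have mZB : measurable (Z @^-1` (psi @^-1` D)) by exact: measurable_funPTI.
have [gA [gB [gAB [cA cB cAB gABE]]]] := UZX _ _ mA mB.
have mXC : measurable (X @^-1` C) by exact: measurable_funPTI.
have [mgA IgA gAE] := cA.
have [mgB IgB gBE] := cB.
have [mgAB IgAB gABi] := cAB.
pose c := fine (P (Z @^-1` (psi @^-1` D))).
have cE : c%:E = P (Z @^-1` (psi @^-1` D)) by rewrite fineK// fin_num_measure.
(* Both functions have the same integral over every measurable set, because [X] and [psi \o Z] are
   independent. *)
have gBc : ae_eq (distribution P X) setT (EFin \o gB) (cst c%:E).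
  have /(cond_probP _ _ mgB) [IgB' gBE'] := cB.
  apply: integral_ae_eq => //= F _ mF.
  rewrite gBE'// integral_cst// cE setIC.
  by rewrite -[RHS]muleC -XZ.
have gBcP : ae_eq P setT (EFin \o (gB \o X)) (cst c%:E).
  case: gBc => N [mN N0 NP]; exists (X @^-1` N); split => //.
    exact: measurable_funPTI.
  by move=> w /= H; apply: NP => /= H'; apply: H => _; exact: H'.
transitivity (\int[P]_(w in X @^-1` C) (gAB (X w))%:E)%E.
  rewrite gABi//; congr (P _); apply/seteqP; split => w /=.
    by move=> [[]].
  by move=> [[]].
transitivity (\int[P]_(w in X @^-1` C) ((gA (X w))%:E * c%:E))%E.
  apply: ae_eq_integral => //.
  - exact: measurable_funTS (measurable_int _ IgAB).
  - apply: emeasurable_funM => //.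
    exact: measurable_funTS (measurable_int _ IgA).
  - apply: filterS2 gABE gBcP => w /= -> gBX _; rewrite EFinM.
    by congr (_ * _)%E; exact: gBX.
rewrite integralZr//; last exact: integrableS IgA.
by rewrite gAE// cE setIC.
Qed.

End conditional_independence.

(** * Positive semidefinite block matrices *)

Section psd.
Context {R : realType}.

Lemma quad_block p q (M : 'M[R]_(p + q)) (a : 'cV_p) (b : 'cV_q) :
  (col_mx a b)^T *m M *m col_mx a b =
  a^T *m ulsubmx M *m a + a^T *m ursubmx M *m b +
  (b^T *m dlsubmx M *m a + b^T *m drsubmx M *m b).
Proof.
rewrite -{1}(submxK M) tr_col_mx mul_row_block mul_row_col !mulmxDl.
by rewrite addrACA.
Qed.

Lemma psd_sub p q (M : 'M[R]_(p + q)) : psd M ->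
  [/\ (ulsubmx M)^T = ulsubmx M, (dlsubmx M)^T = ursubmx M &
      (drsubmx M)^T = drsubmx M].
Proof. by move=> [MT _]; rewrite trmx_ulsub trmx_dlsub trmx_drsub MT. Qed.

Lemma sqr_norm_eq0 p (v : 'cV[R]_p) : (v^T *m v) 0 0 = 0 -> v = 0.
Proof.
rewrite mxE => /eqP; rewrite psumr_eq0; last first.
  by move=> i _; rewrite mxE -expr2 sqr_ge0.
move=> /allP v0; apply/matrixP => i j; rewrite ord1 mxE.
by have := v0 i (mem_index_enum i); rewrite mxE -expr2 sqrf_eq0 => /eqP.
Qed.

(** For [y] in the kernel of the upper left block and [v = dlsubmx M *m y], the form at [(t y, v)]
    is affine in [t] with slope twice the squared norm of [v]. Being nonnegative for all [t], it
    forces [v = 0]. *)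
Lemma psd_feedback p q (M : 'M[R]_(p + q)) : psd M ->
  exists K, dlsubmx M = K *m ulsubmx M.
Proof.
move=> psdM; have [ulT dlT drT] := psd_sub psdM; case: psdM => MT M0.
apply/submxP; rewrite submxE; apply/eqP.
apply/matrixP => i j; rewrite [RHS]mxE.
pose y := col j (cokermx (ulsubmx M)).
have uly : ulsubmx M *m y = 0.
  by rewrite /y colE mulmxA mulmx_coker mul0mx.
pose v := dlsubmx M *m y.
suff v0 : v = 0.
  have : v i 0 = 0 by rewrite v0 mxE.
  by rewrite /v /y colE mulmxA -colE mxE.
apply: sqr_norm_eq0; set s := _ 0 0.
have s0 : 0 <= s.
  by rewrite /s mxE sumr_ge0// => k _; rewrite mxE -expr2 sqr_ge0.
pose c := (v^T *m drsubmx M *m v) 0 0.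
have le t : 0 <= t * s *+ 2 + c.
  have := M0 (col_mx (t *: y) v).
  rewrite quad_block.
  have -> : (t *: y)^T *m ulsubmx M *m (t *: y) = 0.
    by rewrite -mulmxA -scalemxAr uly scaler0 mulmx0.
  have -> : v^T *m dlsubmx M *m (t *: y) = t *: (v^T *m v).
    by rewrite -scalemxAr -mulmxA.
  have -> : (t *: y)^T *m ursubmx M *m v = t *: (v^T *m v).
    by rewrite -dlT linearZ /= -!scalemxAl -trmx_mul.
  by rewrite add0r addrA -scalerDl -mulr2n [_ 0 0]mxE [X in X + _]mxE mulrnAl.
apply/eqP; move: s0; rewrite le_eqVlt => /predU1P[<-//|s0].
(* This [t] makes the affine expression equal to [-1]. *)
have := le (- (c + 1) / (s *+ 2)).
rewrite -mulrnAr mulfVK; last by rewrite mulrn_eq0 /= gt_eqF.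
by rewrite opprD addrAC addNr add0r ler0N1.
Qed.

(** At the vector [(- K^T y, y)] the terms of the two upper blocks cancel, and the form reduces to
    the Schur complement. [K] replaces division by the upper left block, which may be singular. *)
Lemma psd_schur p q (M : 'M[R]_(p + q)) (K : 'M[R]_(q, p)) : psd M ->
    dlsubmx M = K *m ulsubmx M ->
  psd (drsubmx M - K *m (dlsubmx M)^T).
Proof.
move=> psdM dlE; have [ulT dlT drT] := psd_sub psdM; case: psdM => MT M0.
have KdlE : K *m (dlsubmx M)^T = dlsubmx M *m K^T.
  by rewrite dlE trmx_mul ulT mulmxA.
split; first by rewrite linearB /= drT trmx_mul trmxK KdlE.
move=> y; have := M0 (col_mx (- K^T *m y) y).
rewrite quad_block -dlT.
have -> : (- K^T *m y)^T *m ulsubmx M *m (- K^T *m y) +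
    (- K^T *m y)^T *m (dlsubmx M)^T *m y = 0.
  rewrite trmx_mul linearN /= trmxK !mulNmx !mulmxN !mulNmx opprK.
  rewrite -[_ *m K *m _]mulmxA -dlE mulmxA -[_ *m dlsubmx M *m _]mulmxA -KdlE.
  by rewrite !mulmxA subrr.
rewrite add0r mulNmx mulmxN mulmxA -[_ *m dlsubmx M *m _]mulmxA -KdlE.
by rewrite addrC -mulmxBl -mulmxBr.
Qed.

(** Cholesky factorization, splitting off the first row and column. *)
Lemma psd_factor p (M : 'M[R]_p) : psd M -> exists L : 'M[R]_p, M = L *m L^T.
Proof.
elim: p M => [M _|p IHp]; first by exists 0; apply/matrixP => -[].
rewrite -[p.+1]/(1 + p)%N => M psdM.
have [K dlE] := psd_feedback psdM.
have [ulT dlT drT] := psd_sub psdM.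
have [L LE] := IHp _ (psd_schur psdM dlE).
case: psdM => MT M0.
pose a := ulsubmx M 0 0.
have a0 : 0 <= a.
  have := M0 (col_mx 1%:M 0).
  by rewrite quad_block trmx0 trmx1 !mul0mx !mulmx0 mul1mx mulmx1 !addr0.
have ulE : ulsubmx M = a%:M by rewrite [LHS]mx11_scalar.
pose r := Num.sqrt a.
have rr : (r%:M : 'M[R]_1) *m r%:M = ulsubmx M.
  by rewrite -scalar_mxM -expr2 sqr_sqrtr.
(* The entry [K r] stands for the quotient of [dlsubmx M] by [r], so [r = 0] is no special case. *)
exists (block_mx r%:M 0 (K *m r%:M) L).
rewrite tr_block_mx mulmx_block !trmx0 !mul0mx !mulmx0 !addr0.
rewrite trmx_mul tr_scalar_mx !mulmxA rr -[K *m r%:M *m r%:M]mulmxA rr -dlE.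
rewrite -LE addrC -{1}(submxK M) -dlT.
have -> : ulsubmx M *m K^T = (dlsubmx M)^T by rewrite dlE trmx_mul ulT.
have -> : dlsubmx M *m K^T = K *m (dlsubmx M)^T.
  by rewrite dlE trmx_mul ulT mulmxA.
by rewrite subrK.
Qed.

End psd.

Section psd_moment.
Context {d : measure_display} {Omega : measurableType d} {R : realType}.
Variable P : probability Omega R.

Lemma has_moment_unique p q (Z : Omega -> 'M[R]_(p, q)) S S' :
  has_moment P Z S -> has_moment P Z S' -> S = S'.
Proof.
move=> ZS ZS'; apply/matrixP => i j; apply: EFin_inj.
by have [_ <-] := ZS i j; have [_ <-] := ZS' i j.
Qed.

Lemma psd_second_moment p (z : Omega -> 'cV[R]_p) S :
  has_moment P (fun w => z w *m (z w)^T) S -> psd S.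
Proof.
move=> zS; split.
  apply: (has_moment_unique _ zS); have /has_moment_tr := zS; congr has_moment.
  by apply/funext => w; rewrite trmx_mul trmxK.
move=> y; have [_] := has_moment_mulmxr y (has_moment_mulmxl y^T zS) 0 0.
rewrite -lee_fin => <-; apply: expectation_ge0 => w.
rewrite mulmxA -mulmxA -[(z w)^T *m y]trmxK trmx_mul trmxK.
by rewrite mxE sumr_ge0// => k _; rewrite [X in _ * X]mxE -expr2 sqr_ge0.
Qed.

End psd_moment.

(** * Trajectories *)

(** Subfamilies keep the full index range, with zeros outside [J], so that all stacks have the same
    matrix type. *)
Definition masked (J : pred nat) (T V : Type) (zero : V) (X : nat -> T -> V)
    (j : nat) : T -> V :=
  if J j then X j else cst zero.

Section masked_stack.
Context {d : measure_display} {Omega : measurableType d} {R : realType}.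
Variable P : probability Omega R.

Lemma independent_pairl d1 d2 d3 (T1 : measurableType d1)
    (T2 : measurableType d2) (T3 : measurableType d3)
    (X : Omega -> T1) (Y : Omega -> T2) (Z : Omega -> T3) :
    measurable_fun setT X -> measurable_fun setT Y -> measurable_fun setT Z ->
    independent P X (fun w => (Y w, Z w)) -> independent P Y Z ->
  independent P (fun w => (X w, Y w)) Z.
Proof.
move=> mX mY mZ XYZ YZ; apply: independent_pair => // A B C mA mB mC.
have XY : independent P X Y.
  exact: independent_comp (@measurable_id _ T1 setT)
    (@measurable_fst _ _ T2 T3) XYZ.
rewrite XY// -muleA -YZ// -setIA.
exact: (XYZ A (B `*` C) mA (measurableX mB mC)).
Qed.

Lemma measurable_masked p (J : pred nat) (X : nat -> Omega -> 'cV[R]_p) j :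
  measurable_fun setT (X j) -> measurable_fun setT (masked J 0 X j).
Proof. by rewrite /masked; case: ifP. Qed.

Definition mask_mx p k (J : pred nat) (M : 'M[R]_(p, k)) : 'M[R]_(p, k) :=
  \matrix_(i, j) if J j then M i j else 0.

Lemma measurable_mask_mx p k (J : pred nat) :
  measurable_fun setT (@mask_mx p k J).
Proof.
apply/measurable_mxP => i j; under eq_fun do rewrite mxE.
by case: (J j); [exact: (measurable_mx_entry i j)|exact: measurable_cst].
Qed.

(** A smaller subfamily is a measurable image of a larger one, so independence passes to it by
    [independent_comp]. *)
Lemma mask_stack p k (J J' : pred nat) (X : nat -> Omega -> 'cV[R]_p) :
  (forall j, J j -> J' j) ->
  stack k (masked J 0 X) = mask_mx J \o stack k (masked J' 0 X).
Proof.
move=> JJ'; apply/funext => w; apply/matrixP => i j; rewrite !mxE /masked.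
case: ifP => Jj; last by rewrite /= mxE.
by rewrite (JJ' _ Jj).
Qed.

Lemma masked_predT p (X : nat -> Omega -> 'cV[R]_p) :
  masked predT 0 X = X.
Proof. by []. Qed.

Lemma independent_masked_stack p k (J : pred nat)
    (X : nat -> Omega -> 'cV[R]_p) (i : 'I_k) :
    (forall j, (j < k)%N -> measurable_fun setT (X j)) ->
    mutually_independent P (fun j : 'I_k => X j) -> ~~ J i ->
  independent P (stack k (masked J 0 X)) (X i).
Proof.
move=> mX indX Ji; apply: independent_stack.
- by move=> j jk; exact/measurable_masked/mX.
- exact: mX.
move=> B C mB mC.
(* A masked member is constantly [0], so its event is full or empty and can be written as an event
   of [X j]. *)
pose B0 (j : 'I_k) :=
  if J j then B j else if (0 : 'cV[R]_p) \in B j then setT else set0.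
have mB0 j : measurable (B0 j).
  by rewrite /B0; case: ifP => // _; case: ifP.
have B0E (j : 'I_k) : masked J 0 X j @^-1` B j = X j @^-1` B0 j.
  by rewrite /masked /B0; case: ifP => // _; rewrite preimage_cst; case: ifP;
    rewrite ?preimage_setT ?preimage_set0.
under eq_bigcapr do rewrite B0E.
pose B1 j := B0 j `&` (if j == i then C else setT).
have mB1 j : measurable (B1 j).
  by apply: measurableI => //; case: ifP.
have -> : \bigcap_j (X (val j) @^-1` B0 j) `&` X i @^-1` C =
    \bigcap_j (X (val j) @^-1` B1 j).
  apply/seteqP; split => w /=.
    move=> [H Cw] j _; split; first exact: H.
    by case: eqP => // ->.
  move=> H; split; first by move=> j _; case: (H j I).
  by have [_] := H i I; rewrite eqxx.
have -> := indX _ mB0; have -> := indX _ mB1.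
rewrite (bigD1 i)//= [in RHS](bigD1 i)//=.
under eq_bigr => j /negbTE ji do rewrite /B1 ji setIT.
(* As [i] is masked, [B0 i] is full or empty, and the probability splits in either case. *)
have -> : P (X i @^-1` B1 i) = (P (X i @^-1` B0 i) * P (X i @^-1` C))%E.
  rewrite /B1 eqxx /B0 (negbTE Ji); case: ifP => _.
    by rewrite setTI preimage_setT probability_setT mul1e.
  by rewrite set0I preimage_set0 measure0 mul0e.
by rewrite -!muleA; congr (_ * _)%E; rewrite muleC.
Qed.

End masked_stack.

Section dynamics.
Context {R : realType} (n m : nat).
Variables (f : nat -> 'cV[R]_n) (A : nat -> 'M[R]_n) (B : nat -> 'M[R]_(n, m)).
Context {d : measure_display} {Omega : measurableType d}.
Variables (P : probability Omega R) (N : nat).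
Variables (x0 : Omega -> 'cV[R]_n) (w : nat -> Omega -> 'cV[R]_n).
Variables (Sw : nat -> 'M[R]_n).
Hypothesis x0_L2 : square_integrable P x0.
Hypothesis w_moments : forall t, (t < N)%N ->
  [/\ square_integrable P (w t), has_expectation P (w t) 0 &
      has_variance P (w t) (Sw t)].
Hypothesis x0_w_indep :
  mutually_independent P (fun t : 'I_N.+1 => exogenous x0 w t).

Let exo := exogenous x0 w.

Lemma measurable_exogenous j : (j < N.+1)%N -> measurable_fun setT (exo j).
Proof.
case: j => [|j]; first by move=> _; exact: square_integrable_measurable x0_L2.
rewrite ltnS => jN; have [Lw _ _] := w_moments jN.
exact: square_integrable_measurable Lw.
Qed.

(** * Independence of future disturbances under a policy, and moment propagation *)

Section trajectory.
Variable u : nat -> Omega -> 'cV[R]_m.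

Let x := state f A B x0 w u.
Let z t o : 'cV[R]_(1 + n + m) := col_mx (col_mx 1%:M (x t o)) (u t o).

(** Column [t.+1] of the exogenous stack is [w t], so the mask [leq t.+1] keeps [w t] and all later
    disturbances. *)
Lemma policy_independent : is_policy f A B P N x0 w u ->
  forall t, (t <= N)%N ->
    independent P (x t) (stack N.+1 (masked (leq t.+1) 0 exo)) /\
    independent P (fun o => (x t o, u t o))
                  (stack N.+1 (masked (leq t.+1) 0 exo)).
Proof.
move=> pol.
(* The conditional independence required of a policy is used here only, to pass from [x t] to the
   pair. *)
have step t : (t <= N)%N ->
    independent P (x t) (stack N.+1 (masked (leq t.+1) 0 exo)) ->
    independent P (fun o => (x t o, u t o))
                  (stack N.+1 (masked (leq t.+1) 0 exo)).
  move=> tN; have [/square_integrable_measurable mx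
    /square_integrable_measurable mu CI] := pol t tN.
  have mZ := measurable_stack measurable_exogenous.
  pose xM : {mfun Omega >-> 'cV[R]_n} :=
    HB.pack (x t) (isMeasurableFun.Build _ _ _ _ _ mx).
  pose uM : {mfun Omega >-> 'cV[R]_m} :=
    HB.pack (u t) (isMeasurableFun.Build _ _ _ _ _ mu).
  pose ZM : {mfun Omega >-> 'M[R]_(n, N.+1)} :=
    HB.pack (stack N.+1 exo) (isMeasurableFun.Build _ _ _ _ _ mZ).
  pose psi : {mfun 'M[R]_(n, N.+1) >-> 'M[R]_(n, N.+1)} :=
    HB.pack (mask_mx (leq t.+1)) (isMeasurableFun.Build _ _ _ _ _
      (measurable_mask_mx (R := R) (leq t.+1))).
  rewrite (@mask_stack _ _ _ _ _ _ predT)// masked_predT.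
  exact: (@cond_independent_pair _ _ _ P _ _ _ _ _ _ _ _ xM uM ZM psi).
elim=> [_|t IHt tN].
  suff x0W : independent P (x 0) (stack N.+1 (masked (leq 1) 0 exo)).
    by split => //; exact: step.
  apply: independent_sym.
  exact: (independent_masked_stack (i := ord0) measurable_exogenous).
suff xW : independent P (x t.+1) (stack N.+1 (masked (leq t.+2) 0 exo)).
  by split => //; exact: step.
have [_ xuW] := IHt (ltnW tN).
have [/square_integrable_measurable mx
  /square_integrable_measurable mu _] := pol t (ltnW tN).
have mw : measurable_fun setT (w t) by exact: (measurable_exogenous (j := t.+1)).
have mW : measurable_fun setT (stack N.+1 (masked (leq t.+2) 0 exo)).
  by apply: measurable_stack => j jN; exact/measurable_masked/measurable_exogenous.
pose tN' := Ordinal (tN : (t.+1 < N.+1)%N).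
(* The induction hypothesis separates the pair from [w t] and the later disturbances jointly, and
   [w t] is independent of the later ones. *)
have xu_w_W : independent P (fun o => ((x t o, u t o), w t o))
    (stack N.+1 (masked (leq t.+2) 0 exo)).
  apply: independent_pairl => //.
  - exact: measurable_fun_pair.
  - have := @independent_comp _ _ _ P _ _ _ _ _ _ _ _ _ _ id
      (fun M => (col tN' M, mask_mx (leq t.+2) M)) (@measurable_id _ _ setT) _ xuW.
    rewrite (_ : _ \o stack _ _ =
      (fun o => (w t o, stack N.+1 (masked (leq t.+2) 0 exo) o))).
      apply => //; apply: measurable_fun_pair; first exact: measurable_col.
      exact: measurable_mask_mx.
    apply/funext => o; congr pair; first by rewrite col_stack /masked /= leqnn.
    by rewrite (@mask_stack _ _ _ _ _ (leq t.+2) (leq t.+1))// => j; apply: ltnW.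
  - apply: independent_sym.
    apply: (independent_masked_stack (i := tN') measurable_exogenous) => //.
    by rewrite /= ltnn.
have -> : x t.+1 = (fun q : ('cV[R]_n * 'cV[R]_m) * 'cV[R]_n =>
    f t + A t *m q.1.1 + B t *m q.1.2 + q.2) \o
    (fun o => ((x t o, u t o), w t o)) by [].
apply: (independent_comp (h := id)) xu_w_W => //.
apply: measurable_addmx; last exact: measurable_snd.
apply: measurable_addmx; first apply: measurable_addmx => //.
- apply: measurable_mulmxl; apply: measurableT_comp; first exact: measurable_fst.
  exact: measurable_fst.
- apply: measurable_mulmxl; apply: measurableT_comp; first exact: measurable_snd.
  exact: measurable_fst.
Qed.

Lemma has_moment_ulsubmx t (S : 'M[R]_(1 + n + m)) :
  has_moment P (fun o => z t o *m (z t o)^T) S ->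
  has_moment P (fun o => col_mx 1%:M (x t o) *m (col_mx 1%:M (x t o))^T)
    (ulsubmx S).
Proof.
move=> zS i j; have := zS (lshift m i) (lshift m j).
rewrite /ulsubmx !mxE; under eq_fun do rewrite mul_col_trE !col_mxEu -mul_col_trE.
by [].
Qed.

Lemma has_moment_state t (S : 'M[R]_(1 + n + m)) : (t < N)%N ->
    is_policy f A B P N x0 w u ->
    has_moment P (fun o => z t o *m (z t o)^T) S ->
  has_moment P (fun o => col_mx 1%:M (x t.+1 o) *m (col_mx 1%:M (x t.+1 o))^T)
    (system_mx f A B t *m S *m (system_mx f A B t)^T + block_mx 0 0 0 (Sw t)).
Proof.
move=> tN pol zS.
have [Lx Lu _] := pol t (ltnW tN).
have [Lw Ew Vw] := w_moments tN.
have [_ xuW] := policy_independent pol (ltnW tN).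
pose tN' := Ordinal (tN : (t.+1 < N.+1)%N).
have zw : independent P (z t) (w t).
  have := @independent_comp _ _ _ P _ _ _ _ _ _ _ _ _ _
    (fun q : 'cV[R]_n * 'cV[R]_m => col_mx (col_mx 1%:M q.1) q.2)
    (col tN') _ _ xuW.
  rewrite (_ : col tN' \o _ = w t); last first.
    by apply/funext => o /=; rewrite col_stack /masked /= leqnn.
  apply; last exact: measurable_col.
  apply: measurable_col_mx; last exact: measurable_snd.
  by apply: measurable_col_mx; [exact: measurable_cst|exact: measurable_fst].
have Lz : square_integrable P (z t).
  apply: square_integrable_col_mx => //; apply: square_integrable_col_mx => //.
  exact: square_integrable_cst.
have := second_moment_affine (system_mx f A B t) zS
  (has_moment_independent Lz Lw Ew zw) ((has_varianceP _ Lw Ew).1 Vw).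
congr has_moment; apply/funext => o.
suff -> : system_mx f A B t *m z t o + col_mx 0 (w t o) = col_mx 1%:M (x t.+1 o).
  by [].
rewrite /system_mx /z mul_block_col mul0mx addr0 !mul_row_col mul1mx mul0mx addr0.
by rewrite mulmx1 add_col_mx addr0.
Qed.

(** The second moment of [(1, x t.+1)] is computed twice, from the dynamics and as a block of
    [Sigma t.+1]; uniqueness of moments gives the equation. *)
Lemma policy_moment_conditions (Sigma : nat -> 'M[R]_(1 + n + m)) :
  is_policy f A B P N x0 w u -> generates f A B P N x0 w u Sigma ->
  moment_conditions f A B N Sigma Sw.
Proof.
move=> pol gen.
have zS t : (t <= N)%N -> has_moment P (fun o => z t o *m (z t o)^T) (Sigma t).
  move=> tN; have [Lx Lu _] := pol t tN; apply: has_moment_second.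
    apply: square_integrable_col_mx => //; apply: square_integrable_col_mx => //.
    exact: square_integrable_cst.
  exact: gen.
split=> t tN; first exact: psd_second_moment (zS t tN).
have := has_moment_unique (has_moment_state tN pol (zS t (ltnW tN)))
  (has_moment_ulsubmx (zS t.+1 tN)).
by rewrite /Ftilde => <-; rewrite -addrA -opprD subrr.
Qed.

End trajectory.


(** * Affine feedback driven by independent noise *)

Section feedback.
Variables (k : nat -> 'cV[R]_m) (K : nat -> 'M[R]_(m, n)).
Variables (Sv : nat -> 'M[R]_m) (v u : nat -> Omega -> 'cV[R]_m).
Hypothesis noise : is_control_noise P N x0 w v Sv.
Hypothesis feedback : affine_feedback f A B N x0 w u k K v.

Let x := state f A B x0 w u.
Let z t o : 'cV[R]_(1 + n + m) := col_mx (col_mx 1%:M (x t o)) (u t o).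

Let uE t : (t <= N)%N -> u t = fun o => k t + K t *m x t o + v t o.
Proof. by move=> tN; apply/funext => o; exact: feedback. Qed.

Let v_L2 t : (t <= N)%N -> square_integrable P (v t).
Proof. by move=> tN; have [/(_ t tN)[]] := noise. Qed.

Lemma feedback_square_integrable t : (t <= N)%N ->
  square_integrable P (x t) /\ square_integrable P (u t).
Proof.
have step s : (s <= N)%N -> square_integrable P (x s) ->
    square_integrable P (u s).
  move=> sN Lx; rewrite uE//; apply: square_integrableD; last exact: v_L2.
  apply: square_integrableD; first exact: square_integrable_cst.
  exact: square_integrable_mul.
elim: t => [_|t IHt tN]; first by split; [exact: x0_L2|exact: step].
have [Lx Lu] := IHt (ltnW tN); have [Lw _ _] := w_moments tN.
suff Lx' : square_integrable P (x t.+1) by split => //; exact: step.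
apply: square_integrableD => //; apply: square_integrableD.
  apply: square_integrableD; first exact: square_integrable_cst.
  exact: square_integrable_mul.
exact: square_integrable_mul.
Qed.

Let past t := stack N.+1 (masked (fun j => (j < t)%N) 0 v).

(** The state at [t] involves the control noise at times before [t] only. A measurable factor [phi]
    is what transports independence to the state. *)
Lemma feedback_state_factor t : (t <= N)%N ->
  exists2 phi : 'M[R]_(n, N.+1) * 'M[R]_(m, N.+1) -> 'cV[R]_n,
    measurable_fun setT phi & forall o, x t o = phi (stack N.+1 exo o, past t o).
Proof.
elim: t => [_|t IHt tN].
  exists (fun q => col ord0 q.1); last by move=> o; rewrite col_stack.
  by apply: (measurableT_comp (measurable_col ord0)); exact: measurable_fst.
have [phi mphi phiE] := IHt (ltnW tN).
pose tN' := Ordinal (tN : (t.+1 < N.+1)%N).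
pose tN0 := Ordinal (ltnW tN : (t < N.+1)%N).
pose psi (q : 'M[R]_(n, N.+1) * 'M[R]_(m, N.+1)) :=
  phi (q.1, mask_mx (fun j => (j < t)%N) q.2).
have mpsi : measurable_fun setT psi.
  apply: (measurableT_comp mphi); apply: measurable_fun_pair.
    exact: measurable_fst.
  apply: measurableT_comp; first exact: measurable_mask_mx.
  exact: measurable_snd.
(* [psi] recovers [x t] by dropping [v t] from the noise record. Column [t] of that record is [v t],
   and column [t.+1] of the exogenous stack is [w t]. *)
exists (fun q => f t + A t *m psi q +
  B t *m (k t + K t *m psi q + col tN0 q.2) + col tN' q.1); last first.
  move=> o; rewrite /psi /= col_stack col_stack /masked /= ltnSn.
  have <- : past t o = mask_mx (fun j => (j < t)%N) (past t.+1 o).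
    by rewrite /past (@mask_stack _ _ _ _ _ (fun j => (j < t)%N)
      (fun j => (j < t.+1)%N))// => j; apply: ltnW.
  by rewrite -phiE -(feedback (ltnW tN)).
have mcst q (c : 'cV[R]_q) : measurable_fun setT
    (fun _ : 'M[R]_(n, N.+1) * 'M[R]_(m, N.+1) => c).
  exact: measurable_cst.
apply: measurable_addmx; last first.
  by apply: (measurableT_comp (measurable_col tN')); exact: measurable_fst.
apply: measurable_addmx; first by apply: measurable_addmx => //;
  exact: measurable_mulmxl.
apply: measurable_mulmxl; apply: measurable_addmx; last first.
  by apply: (measurableT_comp (measurable_col tN0)); exact: measurable_snd.
by apply: measurable_addmx => //; exact: measurable_mulmxl.
Qed.

Let mv j : (j < N.+1)%N -> measurable_fun setT (v j).
Proof. by move=> jN; exact: square_integrable_measurable (v_L2 jN). Qed.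

(** [v t] is independent of the earlier noise, and the noise as a whole of the exogenous family. So
    [v t] is independent of both together, and these determine the state. *)
Lemma feedback_noise_independent t : (t <= N)%N ->
  independent P (v t) (fun o => (x t o, stack N.+1 exo o)).
Proof.
move=> tN; have [_ indv vZ] := noise.
pose tN' := Ordinal (tN : (t < N.+1)%N).
have mZ := measurable_stack measurable_exogenous.
have mpast : measurable_fun setT (past t).
  by apply: measurable_stack => j jN; exact/measurable_masked/mv.
have [phi mphi phiE] := feedback_state_factor tN.
have Zv : independent P (stack N.+1 exo) (fun o => (past t o, v t o)).
  have := @independent_comp _ _ _ P _ _ _ _ _ _ _ _ _ _ id
    (fun M => (mask_mx (fun j => (j < t)%N) M, col tN' M))
    (@measurable_id _ _ setT) _ (independent_sym vZ).
  rewrite (_ : _ \o stack _ v = (fun o => (past t o, v t o))).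
    apply; apply: measurable_fun_pair; first exact: measurable_mask_mx.
    exact: measurable_col.
  apply/funext => o; congr pair; last exact: col_stack.
  by rewrite /past (@mask_stack _ _ _ _ _ (fun j => (j < t)%N) predT).
have past_v : independent P (past t) (v t).
  apply: (independent_masked_stack (i := tN') mv) => //.
  by rewrite /= ltnn.
have Zpast_v := independent_pairl mZ mpast (mv tN) Zv past_v.
have := @independent_comp _ _ _ P _ _ _ _ _ _ _ _ _ _ id
  (fun q => (phi q, q.1)) (@measurable_id _ _ setT) _ (independent_sym Zpast_v).
rewrite (_ : _ \o (fun o => _) = (fun o => (x t o, stack N.+1 exo o))).
  apply; apply: measurable_fun_pair => //; exact: measurable_fst.
by apply/funext => o /=; rewrite phiE.
Qed.

Lemma feedback_policy : is_policy f A B P N x0 w u.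
Proof.
move=> t tN; have [Lx Lu] := feedback_square_integrable tN; split => //.
have mx := square_integrable_measurable Lx.
have mZ := measurable_stack measurable_exogenous.
pose xM : {mfun Omega >-> 'cV[R]_n} :=
  HB.pack (x t) (isMeasurableFun.Build _ _ _ _ _ mx).
pose vM : {mfun Omega >-> 'cV[R]_m} :=
  HB.pack (v t) (isMeasurableFun.Build _ _ _ _ _ (mv tN)).
pose ZM : {mfun Omega >-> 'M[R]_(n, N.+1)} :=
  HB.pack (stack N.+1 exo) (isMeasurableFun.Build _ _ _ _ _ mZ).
have mh : measurable_fun setT
    (fun q : 'cV[R]_n * 'cV[R]_m => k t + K t *m q.1 + q.2).
  apply: measurable_addmx; last exact: measurable_snd.
  apply: measurable_addmx; first exact: measurable_cst.
  by apply: measurable_mulmxl; exact: measurable_fst.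
rewrite uE//.
exact: (@cond_independent_noise _ _ _ P _ _ _ _ _ _ _ _ xM vM ZM _ mh
  (feedback_noise_independent tN)).
Qed.

(** Two alternating steps: the feedback law completes the upper left block of [Sigma t] to all of
    [Sigma t], and [Ftilde = 0] gives the upper left block at [t.+1]. *)
Lemma feedback_generates (Sigma : nat -> 'M[R]_(1 + n + m)) :
    has_expectation P (fun o => col_mx 1%:M (x0 o) *m (col_mx 1%:M (x0 o))^T)
      (ulsubmx (Sigma 0%N)) ->
    moment_conditions f A B N Sigma Sw ->
    (forall t, (t <= N)%N ->
      dlsubmx (Sigma t) = row_mx (k t) (K t) *m ulsubmx (Sigma t) /\
      Sv t = drsubmx (Sigma t)
             - row_mx (k t) (K t) *m (dlsubmx (Sigma t))^T) ->
  generates f A B P N x0 w u Sigma.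
Proof.
move=> init [psdS FS] gains.
have Lcol t : (t <= N)%N -> square_integrable P (fun o => col_mx 1%:M (x t o)).
  move=> tN; have [Lx _] := feedback_square_integrable tN.
  apply: square_integrable_col_mx => //; exact: square_integrable_cst.
have step t : (t <= N)%N ->
    has_moment P (fun o => col_mx 1%:M (x t o) *m (col_mx 1%:M (x t o))^T)
      (ulsubmx (Sigma t)) ->
    has_moment P (fun o => z t o *m (z t o)^T) (Sigma t).
  move=> tN xS; have [dlE SvE] := gains t tN.
  have [noise_t _ _] := noise; have [Lv Ev Vv] := noise_t t tN.
  have xv : independent P (fun o => col_mx 1%:M (x t o)) (v t).
    apply: independent_sym.
    have := @independent_comp _ _ _ P _ _ _ _ _ _ _ _ _ _ id
      (fun q : 'cV[R]_n * 'M[R]_(n, N.+1) => col_mx (1%:M : 'M[R]_1) q.1)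
      (@measurable_id _ _ setT) _ (feedback_noise_independent tN).
    apply; apply: measurable_col_mx; first exact: measurable_cst.
    exact: measurable_fst.
  (* [(1, x, u)] is this matrix applied to [(1, x)], plus the noise in the last block. *)
  have := second_moment_affine (col_mx 1%:M (row_mx (k t) (K t))) xS
    (has_moment_independent (Lcol t tN) Lv Ev xv) ((has_varianceP _ Lv Ev).1 Vv).
  congr has_moment.
    apply/funext => o.
    suff -> : col_mx 1%:M (row_mx (k t) (K t)) *m col_mx 1%:M (x t o) +
        col_mx 0 (v t o) = z t o by [].
    rewrite mul_col_mx mul1mx mul_row_col mulmx1 add_col_mx addr0.
    by rewrite /z feedback.
  have [ulT dlT drT] := psd_sub (psdS t tN).
  rewrite mul_col_mx mul1mx -dlE tr_col_mx trmx1 mul_col_mx !mul_mx_row !mulmx1.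
  rewrite -/(block_mx _ _ _ _) add_block_mx !addr0 SvE.
  have -> : ulsubmx (Sigma t) *m (row_mx (k t) (K t))^T = ursubmx (Sigma t).
    by rewrite -dlT dlE trmx_mul ulT.
  have -> : dlsubmx (Sigma t) *m (row_mx (k t) (K t))^T =
      row_mx (k t) (K t) *m (dlsubmx (Sigma t))^T.
    by rewrite dlE trmx_mul ulT mulmxA.
  by rewrite addrC subrK submxK.
suff zS t : (t <= N)%N -> has_moment P (fun o => z t o *m (z t o)^T) (Sigma t).
  by move=> t tN; exact: has_moment_expectation (zS t tN).
elim: t => [_|t IHt tN]; apply: step => //.
  by apply: has_moment_second => //; exact: Lcol.
have := has_moment_state tN feedback_policy (IHt (ltnW tN)).
suff -> : system_mx f A B t *m Sigma t *m (system_mx f A B t)^T +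
  block_mx 0 0 0 (Sw t) = ulsubmx (Sigma t.+1) by [].
by apply/esym/eqP; rewrite -subr_eq0 opprD addrA; apply/eqP; exact: FS.
Qed.

End feedback.

End dynamics.

(** * Enlargements and the control noise *)

Section measure_preserving.
Context {d1 d2 : measure_display} {T1 : measurableType d1}
  {T2 : measurableType d2} {R : realType}.
Variables (P1 : probability T1 R) (P2 : probability T2 R).
Variable g : {mfun T1 >-> T2}.
Hypothesis P12 : forall C, measurable C -> P1 (g @^-1` C) = P2 C.

Lemma integral_preserving (h : T2 -> \bar R) : measurable_fun setT h ->
  (\int[P1]_x h (g x) = \int[P2]_y h y)%E.
Proof.
move=> mh.
have ge0 (e : T2 -> \bar R) : measurable_fun setT e -> (forall y, 0 <= e y)%E ->
    (\int[P1]_x e (g x) = \int[P2]_y e y)%E.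
  move=> me e0; rewrite -[LHS]/(\int[P1]_x (e \o g) x)%E.
  rewrite -ge0_integral_distribution//.
  by apply: eq_measure_integral => C mC _; exact: P12.
(* Treating positive and negative parts separately covers every measurable [h], integrable or
   not. *)
rewrite integralE [RHS]integralE.
rewrite -(ge0 _ (measurable_funepos mh))// -(ge0 _ (measurable_funeneg mh))//.
by rewrite -[fun x => h (g x)]/(h \o g) funepos_comp funeneg_comp.
Qed.

Lemma expectation_preserving (X : T2 -> R) : measurable_fun setT X ->
  'E_P1[X \o g]%E = 'E_P2[X]%E.
Proof.
move=> mX; rewrite unlock.
by apply: (integral_preserving (h := EFin \o X)); exact/measurable_EFinP.
Qed.

Lemma Lfun2_preserving (X : T2 -> R) :
  X \in Lfun P2 2%:E -> X \o g \in Lfun P1 2%:E.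
Proof.
move=> LX; have mX := Lfun_measurable LX.
have mXg : measurable_fun setT (X \o g) by exact: measurableT_comp.
have := LX; rewrite !inE => /andP[_]; rewrite inE /finite_norm => NX.
apply/andP; split; first by rewrite inE.
rewrite inE /= /finite_norm; apply: le_lt_trans NX.
rewrite unlock le_eqVlt; apply/orP; left; apply/eqP; congr (_ `^ _)%E.
apply: (integral_preserving (h := fun y => (`|(X y)%:E| `^ 2)%E)).
apply: (measurableT_comp (measurable_poweR _)).
by apply: measurableT_comp => //; exact/measurable_EFinP.
Qed.

Lemma square_integrable_preserving p (X : T2 -> 'cV[R]_p) :
  square_integrable P2 X -> square_integrable P1 (X \o g).
Proof. by move=> LX i; exact: Lfun2_preserving (LX i). Qed.

Lemma has_expectation_preserving p q (Z : T2 -> 'M[R]_(p, q)) S :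
  measurable_fun setT Z -> has_expectation P2 Z S ->
  has_expectation P1 (Z \o g) S.
Proof.
move=> /measurable_mxP mZ ZS i j; rewrite -ZS.
exact: (expectation_preserving (mZ i j)).
Qed.

Lemma has_variance_preserving p (X : T2 -> 'cV[R]_p) S :
  measurable_fun setT X -> has_variance P2 X S -> has_variance P1 (X \o g) S.
Proof.
move=> /measurable_mxP mX XS i j; rewrite -XS unlock.
rewrite -expectation_preserving; last first.
  by apply: measurable_funM; apply: measurable_funB => //; exact: mX.
rewrite -(expectation_preserving (mX i 0)) -(expectation_preserving (mX j 0)).
by [].
Qed.

Lemma mutually_independent_preserving d' (T : measurableType d') k
    (X : 'I_k -> T2 -> T) : (forall i, measurable_fun setT (X i)) ->
  mutually_independent P2 X -> mutually_independent P1 (fun i => X i \o g).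
Proof.
move=> mX indX B mB.
have mXB i : measurable (X i @^-1` B i).
  exact: measurable_preimageT.
transitivity (P2 (\bigcap_i (X i @^-1` B i))).
  rewrite -P12; last by apply: fin_bigcap_measurable => //; exact: finite_finset.
  by congr (P1 _); rewrite preimage_bigcap.
rewrite indX//; apply: eq_bigr => i _.
by rewrite -P12.
Qed.

End measure_preserving.

(** * Uniform laws on finite types *)

Section uniform.
Context {R : realType} (F : finType) (a0 : F).

Lemma card_inv_ge0 : 0 <= (#|F|%:R : R)^-1.
Proof. by rewrite invr_ge0. Qed.

(* [F] is coded in [nat], which already carries the discrete sigma-algebra. *)
Definition uniform_law : set nat -> \bar R :=
  mscale (NngNum card_inv_ge0) (msum (fun i => \d_ i) #|F|).

HB.instance Definition _ := Measure.on uniform_law.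

(** Codes from [#|F|] on are sent to [a0]; they carry no mass. *)
Definition decode (i : nat) : F := nth a0 (enum F) i.

Lemma uniform_lawE (S : pred F) :
  uniform_law (decode @^-1` [set a | S a]) = (#|S|%:R / #|F|%:R)%:E.
Proof.
rewrite /uniform_law /mscale /= /msum mulrC EFinM; congr (_ * _)%E.
rewrite (reindex _ (onW_bij _ (@enum_rank_bij F))) /=.
rewrite -[#|S|]sum1_card natr_sum -sumEFin [RHS]big_mkcond /=.
apply: eq_bigr => a _; rewrite diracE /decode.
case: ifPn => Sa; first by rewrite mem_set//= nth_enum_rank.
by rewrite memNset//= nth_enum_rank; exact/negP.
Qed.

Lemma uniform_law_setT : uniform_law setT = 1%E.
Proof.
have := uniform_lawE predT; rewrite divff; last first.
  by rewrite pnatr_eq0 -lt0n; apply/card_gt0P; exists a0.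
by move=> <-; congr (uniform_law _); apply/seteqP.
Qed.

Definition uniform_prob : probability nat R :=
  HB.pack uniform_law
    (Measure_isProbability.Build _ _ _ uniform_law uniform_law_setT).

Lemma uniform_probE (S : pred F) :
  uniform_prob (decode @^-1` [set a | S a]) = (#|S|%:R / #|F|%:R)%:E.
Proof. exact: uniform_lawE. Qed.

Lemma uniform_prob_expectation (h : F -> R) :
  (h \o decode) \in Lfun uniform_prob 1 /\
  'E_uniform_prob[h \o decode]%E = ((\sum_a h a) / #|F|%:R)%:E.
Proof.
have hE : h \o decode =
    fun i => \sum_a (h a \o* \1_(decode @^-1` [set b | b == a])) i.
  apply/funext => i /=; rewrite (bigD1 (decode i))//= big1 ?addr0.
    by rewrite indicE mem_set ?mul1r//=.
  move=> b bi; rewrite indicE memNset ?mul0r//= => /eqP ib.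
  by rewrite ib eqxx in bi.
rewrite hE mulr_suml.
apply: (expectation_bigsum _
  (X := fun a => h a \o* \1_(decode @^-1` [set b | b == a]))) => a.
have L1 : (\1_(decode @^-1` [set b | b == a]) : nat -> R) \in Lfun uniform_prob 1.
  by apply/Lfun1_integrable; exact: integrable_indic.
rewrite expectationZl// expectation_indic//.
rewrite [X in (_ * X)%E](uniform_probE (pred1 a)) card1 mul1r.
by rewrite -EFinM; split=> //; apply: Lfun_scale.
Qed.

End uniform.

(** * Independent random sign vectors *)

Section rademacher.
Context {R : realType}.

(** Functions subject to one constraint per argument are counted by a product; this is the source of
    independence. *)
Lemma uniform_prob_family k (G : finType) (a0 : {ffun 'I_k -> G})
    (S : 'I_k -> pred G) :
  uniform_prob (R := R) a0
    (decode a0 @^-1` [set a | a \in family S]) =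
  (\prod_(t < k) (#|S t|%:R / #|G|%:R)%:E)%E.
Proof.
rewrite uniform_probE prodEFin; congr _%:E.
rewrite card_family foldrE big_map big_enum /= card_ffun card_ord.
by rewrite prodf_div natr_prod natrX prodr_const card_ord.
Qed.

Lemma uniform_prob_independent k (G : finType) (a0 : {ffun 'I_k -> G})
    d (T : measurableType d) (h : 'I_k -> G -> T) :
  mutually_independent (uniform_prob (R := R) a0)
    (fun t i => h t (decode a0 i t)).
Proof.
move=> B mB.
pose S t : pred G := fun g => h t g \in B t.
have -> : \bigcap_t ((fun i => h t (decode a0 i t)) @^-1` B t) =
    decode a0 @^-1` [set a | a \in family S].
  apply/seteqP; split => i /=.
    by move=> H; apply/familyP => t; rewrite unfold_in; apply/mem_set; exact: H.
  by move=> /familyP H t _; have := H t; rewrite unfold_in => /set_mem.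
rewrite uniform_prob_family; apply: eq_bigr => t _.
(* The marginal event at [t] is again a family of constraints, void at all other arguments. *)
pose S' s : pred G := if s == t then S t else predT.
have -> : (fun i => h t (decode a0 i t)) @^-1` B t =
    decode a0 @^-1` [set a | a \in family S'].
  apply/seteqP; split => i /=.
    move=> H; apply/familyP => s; change (S' s (decode a0 i s)); rewrite /S'.
    by have [->|//] := eqVneq s t; exact: (mem_set H).
  by move=> /familyP/(_ t) St; have : S' t (decode a0 i t) by [];
    rewrite /S' eqxx => /set_mem.
rewrite uniform_prob_family (bigD1 t)//= big1 => [|s /negbTE st].
  by rewrite /S' eqxx mule1.
rewrite /S' st divff// pnatr_eq0 -lt0n.
by apply/card_gt0P; exists (a0 t).
Qed.

Variables (N m : nat).
Let G := {ffun 'I_m -> bool}.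
Let a0 : {ffun 'I_N.+1 -> G} := [ffun=> [ffun=> false]].

Definition rademacher (g : G) : 'cV[R]_m := \col_i (-1) ^+ g i.

(** For [t > N], [inord t] is [0], so the vector of time [0] is repeated; independence is claimed up
    to [N] only. *)
Definition coin (t i : nat) : 'cV[R]_m := rademacher (decode a0 i (inord t)).

Definition coin_prob : probability nat R := uniform_prob a0.

Let flip (j : 'I_m) (a : {ffun 'I_N.+1 -> G}) : {ffun 'I_N.+1 -> G} :=
  [ffun s => [ffun i => a s i (+) (i == j)]].

Let flip_inj j : injective (flip j).
Proof.
apply: (can_inj (g := flip j)) => a; apply/ffunP => s; apply/ffunP => i.
by rewrite !ffunE addbK.
Qed.

(** Flipping coordinate [j] at all times permutes the outcomes, so an odd function sums to its own
    opposite. This yields zero means and uncorrelated entries. *)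
Lemma sum_flip (h : {ffun 'I_N.+1 -> G} -> R) j :
  (forall a, h (flip j a) = - h a) -> \sum_a h a = 0.
Proof.
move=> hj; apply/eqP; rewrite -eqNr [X in _ == X](reindex_inj (@flip_inj j)).
by rewrite -sumrN; apply/eqP; apply: eq_bigr => a _; rewrite hj.
Qed.

Lemma coin_square_integrable t : square_integrable coin_prob (coin t).
Proof.
(* The entries have absolute value [1], so their norm is that of the constant [1]. *)
move=> i; have := Lfun_cst coin_prob 1 2; rewrite !inE => /andP[_].
rewrite inE /= /finite_norm -Lnorm_abse => N1.
apply/andP; split; first by rewrite inE.
rewrite inE /= /finite_norm -Lnorm_abse; congr (_ < _)%E: N1.
congr Lnorm; apply/funext => k /=.
by rewrite mxE normrX normrN !normr1 expr1n.
Qed.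

Lemma coin_expectation t : has_expectation coin_prob (coin t) 0.
Proof.
move=> i j; have [_] := uniform_prob_expectation a0
  (fun a => rademacher (a (inord t)) i j).
rewrite (sum_flip (j := i)) ?mul0r ?mxE// => a.
by rewrite !mxE !ffunE eqxx addbT signrN.
Qed.

Lemma coin_second_moment t :
  has_moment coin_prob (fun k => coin t k *m (coin t k)^T) 1%:M.
Proof.
apply: has_moment_second; first exact: coin_square_integrable.
move=> i j; have [_] := uniform_prob_expectation a0
  (fun a => rademacher (a (inord t)) i 0 * rademacher (a (inord t)) j 0).
under [in X in _ -> X]eq_fun do rewrite mul_col_trE.
move=> ->; rewrite mxE; case: (eqVneq i j) => [<-|ij].
  under eq_bigr do rewrite !mxE -expr2 sqrr_sign.
  rewrite sumr_const divff// pnatr_eq0 -lt0n.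
  by apply/card_gt0P; exists a0.
(* Since [j] differs from [i], the flip changes the sign of one factor only. *)
rewrite (sum_flip (j := i)) ?mul0r// => a.
by rewrite !mxE !ffunE eqxx [j == i]eq_sym (negbTE ij) addbT addbF signrN mulNr.
Qed.

End rademacher.

(** * Control noise on a product space *)

Section product_noise.
Context {d : measure_display} {Omega : measurableType d} {R : realType}.
Variable P : probability Omega R.

Lemma product_fst d' (T : measurableType d') (Q : probability T R) C :
  measurable C -> (P \x Q)%E (fst @^-1` C) = P C.
Proof.
move=> mC; rewrite -[P C]mule1 -(probability_setT Q) -product_measure1E//.
by congr (product_measure1 _ _ _); apply/seteqP; split => -[a b] //= [].
Qed.

Lemma product_snd d' (T : measurableType d') (Q : probability T R) C :
  measurable C -> (P \x Q)%E (snd @^-1` C) = Q C.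
Proof.
move=> mC; rewrite -[Q C]mul1e -(probability_setT P) -product_measure1E//.
by congr (product_measure1 _ _ _); apply/seteqP; split => -[a b] //= [].
Qed.

Lemma independent_snd_fst d1 d2 d3 (T : measurableType d1)
    (T1 : measurableType d2) (T2 : measurableType d3)
    (Q : probability T R) (X : T -> T1) (Y : Omega -> T2) :
    measurable_fun setT X -> measurable_fun setT Y ->
  independent (P \x Q)%E (X \o snd) (Y \o fst).
Proof.
move=> mX mY C D mC mD.
have mXC : measurable (X @^-1` C) by exact: measurable_preimageT.
have mYD : measurable (Y @^-1` D) by exact: measurable_preimageT.
transitivity ((P \x Q)%E (Y @^-1` D `*` X @^-1` C)).
  by congr (product_measure1 _ _ _); apply/seteqP; split => -[a b] [].
rewrite product_measure1E// muleC; congr (_ * _)%E; apply/esym.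
  exact: (product_snd Q mXC).
exact: (product_fst Q mYD).
Qed.

Definition fst_mfun d' (T : measurableType d') :
    {mfun (Omega * T)%type >-> Omega} :=
  HB.pack (fst : Omega * T -> Omega)
    (isMeasurableFun.Build _ _ _ _ _ measurable_fst).

Definition snd_mfun d' (T : measurableType d') : {mfun (Omega * T)%type >-> T} :=
  HB.pack (snd : Omega * T -> T)
    (isMeasurableFun.Build _ _ _ _ _ measurable_snd).

Definition product_enlargement d' (T : measurableType d') (Q : probability T R) :
    enlargement P :=
  @Enlargement _ _ _ P _ (Omega * T)%type (P \x Q)%E (fst_mfun T)
    (@product_fst _ _ Q).

(** The sign vectors have identity second moment, so [L t] gives them covariance [L t *m (L t)^T].
    They live on the second factor, hence are independent of the exogenous data on the first. *)
Lemma control_noise_exists N n m (x0 : Omega -> 'cV[R]_n)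
    (w : nat -> Omega -> 'cV[R]_n) (L : nat -> 'M[R]_m) :
    (forall j, (j < N.+1)%N -> measurable_fun setT (exogenous x0 w j)) ->
  is_control_noise (P \x coin_prob (R := R) N m)%E N (x0 \o fst)
    (fun t => w t \o fst) (fun t => (fun i => L t *m @coin R N m t i) \o snd)
    (fun t => L t *m (L t)^T).
Proof.
move=> mexo.
pose Q := coin_prob (R := R) N m.
pose v t i := L t *m @coin R N m t i.
have mv t : measurable_fun setT (v t) by [].
have Lv t : square_integrable Q (v t).
  exact: (square_integrable_mul (L t) (@coin_square_integrable R N m t)).
have Ev t : has_expectation Q (v t) 0.
  have := has_moment_mulmxl (L t) (P := Q) (Z := @coin R N m t) (S := 0).
  rewrite mulmx0 => H; apply: has_moment_expectation; apply: H => i j.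
  split; last exact: coin_expectation.
  by rewrite ord1; apply: Lfun2_Lfun1; exact: coin_square_integrable.
have Vv t : has_variance Q (v t) (L t *m (L t)^T).
  apply/(has_varianceP _ (Lv t) (Ev t)).
  have := has_moment_mulmxr (L t)^T
    (has_moment_mulmxl (L t) (@coin_second_moment R N m t)).
  rewrite mulmx1; congr has_moment; apply/funext => i.
  by rewrite /v trmx_mul !mulmxA.
have sndP := @product_snd _ _ Q.
split.
- move=> t _; split.
  + exact: (square_integrable_preserving (g := snd_mfun nat) sndP (Lv t)).
  + exact: (has_expectation_preserving (g := snd_mfun nat) sndP (mv t) (Ev t)).
  + exact: (has_variance_preserving (g := snd_mfun nat) sndP (mv t) (Vv t)).
- apply: (mutually_independent_preserving (g := snd_mfun nat) sndP
      (X := fun t => v t)); first by [].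
  have := @uniform_prob_independent R N.+1 _ [ffun=> [ffun=> false]] _ _
    (fun t (g : {ffun 'I_m -> bool}) => L t *m rademacher g).
  congr mutually_independent; apply/funext => t; apply/funext => i.
  by rewrite /v /coin inord_val.
- have := @independent_snd_fst _ _ _ nat _ _ Q (stack N.+1 v)
    (stack N.+1 (exogenous x0 w)) _ (measurable_stack mexo).
  have -> : stack N.+1 (exogenous (x0 \o fst) (fun t => w t \o fst)) =
      stack N.+1 (exogenous x0 w) \o (fst : Omega * nat -> Omega).
    apply/funext => o; apply/matrixP => i j; rewrite !mxE.
    by case: (val j).
  by apply.
Qed.

End product_noise.

Section closed_loop.
Context {R : realType} (n m : nat).
Variables (f : nat -> 'cV[R]_n) (A : nat -> 'M[R]_n) (B : nat -> 'M[R]_(n, m)).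
Context {Omega : Type}.
Variables (x0 : Omega -> 'cV[R]_n) (w : nat -> Omega -> 'cV[R]_n).
Variables (k : nat -> 'cV[R]_m) (K : nat -> 'M[R]_(m, n)).
Variable v : nat -> Omega -> 'cV[R]_m.

(** [state] takes the inputs as given, while feedback inputs depend on the state. Substituting the
    feedback law into the recursion removes this circularity. *)
Fixpoint closed_loop (t : nat) (o : Omega) : 'cV[R]_n :=
  if t is s.+1 then
    f s + A s *m closed_loop s o +
    B s *m (k s + K s *m closed_loop s o + v s o) + w s o
  else x0 o.

Definition closed_loop_input (t : nat) (o : Omega) : 'cV[R]_m :=
  k t + K t *m closed_loop t o + v t o.

End closed_loop.

Lemma closed_loop_state (R : realType) n m f (A : nat -> 'M[R]_n)
    (B : nat -> 'M[R]_(n, m)) d (Omega : measurableType d)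
    (x0 : Omega -> 'cV[R]_n) w k K v t o :
  state f A B x0 w (closed_loop_input f A B x0 w k K v) t o =
  closed_loop f A B x0 w k K v t o.
Proof. by elim: t => //= t ->. Qed.

Lemma measurable_closed_loop_input (R : realType) n m f (A : nat -> 'M[R]_n)
    (B : nat -> 'M[R]_(n, m)) d (Omega : measurableType d)
    (x0 : Omega -> 'cV[R]_n) w k K v t :
    measurable_fun setT x0 -> (forall s, measurable_fun setT (w s)) ->
    (forall s, measurable_fun setT (v s)) ->
  measurable_fun setT (closed_loop_input f A B x0 w k K v t).
Proof.
move=> mx0 mw mv.
have mcst q (c : 'cV[R]_q) : measurable_fun setT (fun _ : Omega => c).
  exact: measurable_cst.
have input s : measurable_fun setT (closed_loop f A B x0 w k K v s) ->
    measurable_fun setT (closed_loop_input f A B x0 w k K v s).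
  move=> mx; apply: measurable_addmx => //; apply: measurable_addmx => //.
  exact: measurable_mulmxl.
apply: (input t); elim: t => // t IHt.
apply: measurable_addmx => //; apply: measurable_addmx.
  by apply: measurable_addmx => //; exact: measurable_mulmxl.
by apply: measurable_mulmxl; exact: input.
Qed.

Theorem theorem1 (R : realType) (d : measure_display) (Omega : measurableType d)
    (P : probability Omega R) (N n m : nat)
    (f : nat -> 'cV[R]_n) (A : nat -> 'M[R]_n) (B : nat -> 'M[R]_(n, m))
    (x0 : {RV P >-> 'cV[R]_n}) (w : nat -> {RV P >-> 'cV[R]_n})
    (Sw : nat -> 'M[R]_n)
    (x0_L2 : square_integrable P x0)
    (w_moments : forall t, (t < N)%N ->
      [/\ square_integrable P (w t), has_expectation P (w t) 0 &
          has_variance P (w t) (Sw t)])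
    (x0_w_indep :
      mutually_independent P (fun t : 'I_N.+1 => exogenous x0 w t))
    (Sigma : nat -> 'M[R]_(1 + n + m))
    (Sigma_sym : forall t, (t <= N)%N -> (Sigma t)^T = Sigma t)
    (Sigma_init : has_expectation P
      (fun o => col_mx 1%:M (x0 o) *m (col_mx 1%:M (x0 o))^T)
      (ulsubmx (Sigma 0%N))) :
  ((exists (E : enlargement P) (u : nat -> {RV ext_prob E >-> 'cV[R]_m}),
      let y0 := x0 \o ext_proj E in
      let wE := fun t => w t \o ext_proj E in
      is_policy f A B (ext_prob E) N y0 wE u /\
      generates f A B (ext_prob E) N y0 wE u Sigma)
   <-> moment_conditions f A B N Sigma Sw)
  /\
  (moment_conditions f A B N Sigma Sw ->
   exists (k : nat -> 'cV[R]_m) (K : nat -> 'M[R]_(m, n)) (Sv : nat -> 'M[R]_m),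
     [/\ forall t, (t <= N)%N ->
           [/\ dlsubmx (Sigma t) = row_mx (k t) (K t) *m ulsubmx (Sigma t),
               Sv t = drsubmx (Sigma t)
                      - row_mx (k t) (K t) *m (dlsubmx (Sigma t))^T &
               psd (Sv t)],
         exists (E : enlargement P) (v u : nat -> {RV ext_prob E >-> 'cV[R]_m}),
           let y0 := x0 \o ext_proj E in
           let wE := fun t => w t \o ext_proj E in
           is_control_noise (ext_prob E) N y0 wE v Sv /\
           affine_feedback f A B N y0 wE u k K v &
         forall (E : enlargement P) (v u : nat -> {RV ext_prob E >-> 'cV[R]_m}),
           let y0 := x0 \o ext_proj E in
           let wE := fun t => w t \o ext_proj E in
           is_control_noise (ext_prob E) N y0 wE v Sv ->
           affine_feedback f A B N y0 wE u k K v ->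
           is_policy f A B (ext_prob E) N y0 wE u /\
           generates f A B (ext_prob E) N y0 wE u Sigma]).
Proof.
have mexo j : measurable_fun setT (exogenous x0 w j).
  by case: j => [|j]; exact: measurable_funP.
have mx0 : measurable_fun setT x0 by exact: measurable_funP.
(* The projection preserves the law, so every hypothesis on [x0] and [w] holds on the enlarged space
   too. *)
have ext (E : enlargement P) :
    [/\ square_integrable (ext_prob E) (x0 \o ext_proj E),
        forall t, (t < N)%N ->
          [/\ square_integrable (ext_prob E) (w t \o ext_proj E),
              has_expectation (ext_prob E) (w t \o ext_proj E) 0 &
              has_variance (ext_prob E) (w t \o ext_proj E) (Sw t)],
        mutually_independent (ext_prob E) (fun t : 'I_N.+1 =>
          exogenous (x0 \o ext_proj E) (fun t => w t \o ext_proj E) t) &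
        has_expectation (ext_prob E) (fun o =>
            col_mx 1%:M ((x0 \o ext_proj E) o) *m
            (col_mx 1%:M ((x0 \o ext_proj E) o))^T)
          (ulsubmx (Sigma 0%N))].
  have law := @ext_law _ _ _ _ E; split.
  - exact: (square_integrable_preserving law x0_L2).
  - move=> t tN; have [Lw Ew Vw] := w_moments t tN.
    have mw : measurable_fun setT (w t) by exact: measurable_funP.
    split; [exact: (square_integrable_preserving law Lw)|
      exact: (has_expectation_preserving law mw Ew)|
      exact: (has_variance_preserving law mw Vw)].
  - have := mutually_independent_preserving law (fun i => mexo (val i)) x0_w_indep.
    by congr mutually_independent; apply/funext => -[[|t] tN].
  - apply: (has_expectation_preserving law _ Sigma_init).
    have := @square_integrable_col_mx _ _ _ P _ _ _ _
      (square_integrable_cst P (1%:M : 'cV[R]_1)) x0_L2.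
    move=> /square_integrable_measurable/measurable_mxP mz.
    apply/measurable_mxP => i j; under eq_fun do rewrite mul_col_trE.
    by apply: measurable_funM; exact: mz.
have feedback (k : nat -> 'cV[R]_m) (K : nat -> 'M[R]_(m, n)) Sv :
    moment_conditions f A B N Sigma Sw ->
    (forall t, (t <= N)%N ->
      dlsubmx (Sigma t) = row_mx (k t) (K t) *m ulsubmx (Sigma t) /\
      Sv t = drsubmx (Sigma t)
             - row_mx (k t) (K t) *m (dlsubmx (Sigma t))^T) ->
    forall (E : enlargement P) (v u : nat -> {RV ext_prob E >-> 'cV[R]_m}),
      let y0 := x0 \o ext_proj E in
      let wE := fun t => w t \o ext_proj E in
      is_control_noise (ext_prob E) N y0 wE v Sv ->
      affine_feedback f A B N y0 wE u k K v ->
      is_policy f A B (ext_prob E) N y0 wE u /\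
      generates f A B (ext_prob E) N y0 wE u Sigma.
  move=> mc gains E v u y0 wE noise fb.
  have [Ly0 wE_moments indep init] := ext E; split.
    exact: (feedback_policy Ly0 wE_moments noise fb).
  exact: (feedback_generates Ly0 wE_moments indep noise fb init mc gains).
have gains : moment_conditions f A B N Sigma Sw ->
    exists (k : nat -> 'cV[R]_m) (K : nat -> 'M[R]_(m, n)) (Sv : nat -> 'M[R]_m),
    (forall t, (t <= N)%N ->
           [/\ dlsubmx (Sigma t) = row_mx (k t) (K t) *m ulsubmx (Sigma t),
               Sv t = drsubmx (Sigma t)
                      - row_mx (k t) (K t) *m (dlsubmx (Sigma t))^T &
               psd (Sv t)]) /\
    exists (E : enlargement P) (v u : nat -> {RV ext_prob E >-> 'cV[R]_m}),
           let y0 := x0 \o ext_proj E in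
           let wE := fun t => w t \o ext_proj E in
           is_control_noise (ext_prob E) N y0 wE v Sv /\
           affine_feedback f A B N y0 wE u k K v.
  move=> [psdS _].
  (* Gain and noise factor are chosen together, since the factor is that of the Schur complement for
     this gain; past the horizon both are [0]. *)
  have /choice[kK kKE] : forall t, exists kKL : 'M[R]_(m, 1 + n) * 'M[R]_m,
      (t <= N)%N ->
      dlsubmx (Sigma t) = kKL.1 *m ulsubmx (Sigma t) /\
      drsubmx (Sigma t) - kKL.1 *m (dlsubmx (Sigma t))^T = kKL.2 *m kKL.2^T.
    move=> t; have [tN|tN] := leqP t N; last by exists (0, 0) => //.
    have [C CE] := psd_feedback (psdS t tN).
    have [L LE] := psd_factor (psd_schur (psdS t tN) CE).
    by exists (C, L).
  pose k t := lsubmx (kK t).1; pose K t := rsubmx (kK t).1.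
  pose L t := (kK t).2.
  exists k, K, (fun t => L t *m (L t)^T); split.
    move=> t tN; have [CE LE] := kKE t tN.
    rewrite hsubmxK; split => //; rewrite /L -LE.
    exact: psd_schur (psdS t tN) CE.
  pose E := product_enlargement P (coin_prob (R := R) N m).
  have mv t : measurable_fun setT
      ((fun i => L t *m @coin R N m t i) \o snd : ext_space E -> _).
    by apply: measurableT_comp => //; exact: measurable_snd.
  pose v t : {RV ext_prob E >-> 'cV[R]_m} :=
    HB.pack ((fun i => L t *m @coin R N m t i) \o snd : ext_space E -> _)
      (isMeasurableFun.Build _ _ _ _ _ (mv t)).
  pose u0 := closed_loop_input f A B (x0 \o ext_proj E)
    (fun t => w t \o ext_proj E) k K v.
  have mu t : measurable_fun setT (u0 t).
    apply: measurable_closed_loop_input => [|s|s].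
    - exact: measurableT_comp.
    - exact: measurableT_comp.
    - exact: mv.
  pose u t : {RV ext_prob E >-> 'cV[R]_m} :=
    HB.pack (u0 t) (isMeasurableFun.Build _ _ _ _ _ (mu t)).
  exists E, v, u; split.
    by apply: control_noise_exists => j _; exact: mexo.
  by move=> t _ o; rewrite closed_loop_state.
split; last first.
  move=> mc; have [k [K [Sv [gainsE noise]]]] := gains mc.
  exists k, K, Sv; split => //; apply: feedback => // t tN.
  by have [] := gainsE t tN.
split.
  move=> [E [u [pol gen]]]; have [Ly0 wE_moments indep _] := ext E.
  exact: (policy_moment_conditions Ly0 wE_moments indep pol gen).
(* The affine feedback policy is itself the witness for the converse. *)
move=> mc; have [k [K [Sv [gainsE [E [v [u [noise fb]]]]]]]] := gains mc.
exists E, u; apply: (feedback k K Sv) noise fb => // t tN.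
by have [] := gainsE t tN.
Qed.
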